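(* Let $G$ be a discrete group acting from the left on a set $S$, let $\Lambda\subseteq S$ be a set containing exactly one point of each $G$-orbit, and for $x\in\Lambda$ let $H_x=\mathrm{Stab}_G(x)$. Regard $\ell^1(S)$ as a Banach $\ell^1(G)$-bimodule with left action $e_g\cdot\delta_s=\delta_{g\cdot s}$ and right action $\delta_s\cdot e_g=\delta_s$. Then for each $n\ge0$, $H^n(\ell^1(G),\ell^1(S)')$ is topologically isomorphic to the $n$-th cohomology group of the cochain complex \[0\to\bigoplus^{\ell^\infty}_{x\in\Lambda}C^0(\ell^1(H_x),\mathbb C)\to\bigoplus^{\ell^\infty}_{x\in\Lambda}C^1(\ell^1(H_x),\mathbb C)\to\cdots\] whose coboundary maps are the coordinatewise $\ell^\infty$-sums of the Hochschild coboundaries of the complexes $C^*(\ell^1(H_x),\mathbb C)$, where $\mathbb C$ is the $\ell^1(H_x)$-bimodule with both actions given by the augmentation character.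
   Context: For a discrete group $G$, $\ell^1(G)$ is its convolution algebra with basis $(e_g)$; the augmentation character sends each $e_g$ to $1$. For a Banach algebra $A$ and Banach bimodule $M$, $C^n(A,M)$ is the Banach space of bounded $n$-linear maps $A^n\to M$ with the Hochschild coboundary $(\delta\psi)(a_1,\dots,a_{n+1})=a_1\psi(a_2,\dots)+\sum_{j=1}^n(-1)^j\psi(\dots,a_ja_{j+1},\dots)+(-1)^{n+1}\psi(a_1,\dots,a_n)a_{n+1}$, and $H^n(A,M)$ is its cohomology. $M'$ carries the adjoint bimodule structure. $\bigoplus^{\ell^\infty}_{x}E(x)$ is the space of bounded families $(v_x)$ with sup norm. Two seminormed quotient spaces are topologically isomorphic if there is a linear bijection which is a homeomorphism. *)

(* Defs.v *)
From mathcomp Require Import all_boot all_order all_algebra.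
From mathcomp Require Import complex.
From mathcomp Require Import boolp classical_sets reals ereal esum.

Set Implicit Arguments.
Unset Strict Implicit.
Unset Printing Implicit Defensive.

Import Order.TTheory GRing.Theory Num.Theory.
Local Open Scope ring_scope.
Local Open Scope classical_set_scope.

(* Elements of l^1(T) are functions T -> C with finite l^1 norm; the basis    *)
(* vector e_g (resp. delta_s) is the indicator function of g (resp. s).       *)

Section L1.
Variable R : realType.
Local Notation C := R[i].

Definition cabs (z : C) : R := ComplexField.Normc.normc z.

Variable T : choiceType.

Definition l1 (f : T -> C) : Prop :=
  (\esum_(t in [set: T]) (cabs (f t))%:E < +oo)%E.

Definition l1norm (f : T -> C) : R :=
  fine (\esum_(t in [set: T]) (cabs (f t))%:E).

(* unconditional sum of an absolutely summable complex family, computed as   *)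
(* (sum Re^+ - sum Re^-) + i (sum Im^+ - sum Im^-)                            *)
Definition rsum (u : T -> R) : R :=
  fine (\esum_(t in [set: T]) (Num.max (u t) 0)%:E)
  - fine (\esum_(t in [set: T]) (Num.max (- u t) 0)%:E).

Definition csum (f : T -> C) : C :=
  Complex (rsum (fun t => @complex.Re R (f t)))
          (rsum (fun t => @complex.Im R (f t))).

Definition supp_in (P : set T) (f : T -> C) : Prop :=
  forall t, ~ P t -> f t = 0.

End L1.

Section Group.
Variable R : realType.
Local Notation C := R[i].
Variable G : groupType.

Definition conv (a b : G -> C) : G -> C :=
  fun h => csum (fun g => a g * b (g^-1 * h)%g).

Definition aug (a : G -> C) : C := csum a.

(* l^1(H) for a subgroup H of G, realised as the (closed) subalgebra of      *)
(* l^1(G) of the elements supported in H (isometrically isomorphic).         *)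
Definition l1on (H : set G) : set (G -> C) := [set a | l1 a /\ supp_in H a].

Definition ctail n (a : 'I_n.+1 -> G -> C) : 'I_n -> G -> C :=
  fun i => a (lift ord0 i).
Definition cinit n (a : 'I_n.+1 -> G -> C) : 'I_n -> G -> C :=
  fun i => a (widen_ord (leqnSn n) i).
(* (a_1, ..., a_j a_(j+1), ..., a_(n+1)) for the 0-based position j < n *)
Definition cmerge n (a : 'I_n.+1 -> G -> C) (j : 'I_n) : 'I_n -> G -> C :=
  fun i => if (i < j)%N then a (widen_ord (leqnSn n) i)
           else if i == j then conv (a (widen_ord (leqnSn n) i)) (a (lift ord0 i))
           else a (lift ord0 i).
Definition cupd n (a : 'I_n -> G -> C) (i : 'I_n) (v : G -> C) : 'I_n -> G -> C :=
  fun j => if j == i then v else a j.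

Definition cscale (c : C) (a : G -> C) : G -> C := fun g => c * a g.
Definition cadd (a b : G -> C) : G -> C := fun g => a g + b g.

(* psi : ('I_n -> G -> C) -> C, considered on arguments in A = l^1(H)       *)

Definition multilinC (A : set (G -> C)) n (psi : ('I_n -> G -> C) -> C) :=
  forall (a : 'I_n -> G -> C) (i : 'I_n) (b : G -> C) (c : C),
    (forall j, A (a j)) -> A b ->
    psi (cupd a i (cadd (cscale c (a i)) b)) = c * psi a + psi (cupd a i b).

Definition boundedC (A : set (G -> C)) n (psi : ('I_n -> G -> C) -> C) :=
  exists M : R, forall a : 'I_n -> G -> C, (forall j, A (a j)) ->
    cabs (psi a) <= M * \prod_(j < n) l1norm (a j).

Definition cochC (A : set (G -> C)) n psi :=
  multilinC A psi /\ @boundedC A n psi.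

(* equality of cochains (they are determined by their values on A^n) *)
Definition eqC (A : set (G -> C)) n (psi phi : ('I_n -> G -> C) -> C) :=
  forall a : 'I_n -> G -> C, (forall j, A (a j)) -> psi a = phi a.

Definition normC (A : set (G -> C)) n (psi : ('I_n -> G -> C) -> C) : R :=
  sup [set r : R | exists a : 'I_n -> G -> C,
          (forall j, A (a j) /\ l1norm (a j) <= 1) /\ r = cabs (psi a)].

(* Hochschild coboundary, C being a bimodule via the augmentation character *)
Definition cobC n (psi : ('I_n -> G -> C) -> C) : ('I_n.+1 -> G -> C) -> C :=
  fun a => aug (a ord0) * psi (ctail a)
         + \sum_(j < n) (-1) ^+ j.+1 * psi (cmerge a j)
         + (-1) ^+ n.+1 * (psi (cinit a) * aug (a ord_max)).

Variable S : choiceType.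
Variable act : G -> S -> S.

(* module structure of l^1(S): (e_g . delta_s) = delta_(g.s), delta_s . e_g = delta_s *)
Definition lact (a : G -> C) (xi : S -> C) : S -> C :=
  fun s => csum (fun g => a g * xi (act g^-1 s)).
Definition ract (xi : S -> C) (a : G -> C) : S -> C :=
  fun s => xi s * aug a.

(* An element of C^n(l^1(G), l^1(S)') is an n-linear map psi with values in  *)
(* the dual l^1(S)'; we write it curried: Psi a xi = <psi(a), xi>.            *)
Definition multilinD n (Psi : ('I_n -> G -> C) -> (S -> C) -> C) :=
  (forall (a : 'I_n -> G -> C) (i : 'I_n) (b : G -> C) (c : C) (xi : S -> C),
    (forall j, l1 (a j)) -> l1 b -> l1 xi ->
    Psi (cupd a i (cadd (cscale c (a i)) b)) xi
      = c * Psi a xi + Psi (cupd a i b) xi)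
  /\
  (forall (a : 'I_n -> G -> C) (xi eta : S -> C) (c : C),
    (forall j, l1 (a j)) -> l1 xi -> l1 eta ->
    Psi a (fun s => c * xi s + eta s) = c * Psi a xi + Psi a eta).

Definition boundedD n (Psi : ('I_n -> G -> C) -> (S -> C) -> C) :=
  exists M : R, forall (a : 'I_n -> G -> C) (xi : S -> C),
    (forall j, l1 (a j)) -> l1 xi ->
    cabs (Psi a xi) <= M * (\prod_(j < n) l1norm (a j)) * l1norm xi.

Definition cochD n Psi := @multilinD n Psi /\ boundedD Psi.

Definition eqD n (Psi Phi : ('I_n -> G -> C) -> (S -> C) -> C) :=
  forall (a : 'I_n -> G -> C) (xi : S -> C),
    (forall j, l1 (a j)) -> l1 xi -> Psi a xi = Phi a xi.

Definition normD n (Psi : ('I_n -> G -> C) -> (S -> C) -> C) : R :=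
  sup [set r : R | exists (a : 'I_n -> G -> C) (xi : S -> C),
          [/\ forall j, l1 (a j) /\ l1norm (a j) <= 1,
              l1 xi, l1norm xi <= 1 & r = cabs (Psi a xi)]].

(* Hochschild coboundary for the dual bimodule l^1(S)':                       *)
(* <a.phi, xi> = <phi, xi.a>,  <phi.a, xi> = <phi, a.xi>                      *)
Definition cobD n (Psi : ('I_n -> G -> C) -> (S -> C) -> C)
  : ('I_n.+1 -> G -> C) -> (S -> C) -> C :=
  fun a xi => Psi (ctail a) (ract xi (a ord0))
            + \sum_(j < n) (-1) ^+ j.+1 * Psi (cmerge a j) xi
            + (-1) ^+ n.+1 * Psi (cinit a) (lact (a ord_max) xi).

Definition cocycD n (Psi : ('I_n -> G -> C) -> (S -> C) -> C) :=
  cochD Psi /\ eqD (cobD Psi) (fun _ _ => 0).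

Definition cobndD n : (('I_n -> G -> C) -> (S -> C) -> C) -> Prop :=
  match n as n0 return (('I_n0 -> G -> C) -> (S -> C) -> C) -> Prop with
  | 0 => fun Psi => eqD Psi (fun _ _ => 0)
  | m.+1 => fun Psi => exists Phi, @cochD m Phi /\ eqD (cobD Phi) Psi
  end.

Definition qnormD n (Psi : ('I_n -> G -> C) -> (S -> C) -> C) : R :=
  inf [set r : R | exists B, @cobndD n B /\
                    r = normD (fun a xi => Psi a xi - B a xi)].

Variable Lam : set S.

Definition stab (x : S) : set G := [set g | act g x = x].

Definition cochF n (Phi : S -> ('I_n -> G -> C) -> C) :=
  (forall x, Lam x -> cochC (l1on (stab x)) (Phi x))
  /\ exists M : R, forall x, Lam x -> normC (l1on (stab x)) (Phi x) <= M.

Definition eqF n (Phi Psi : S -> ('I_n -> G -> C) -> C) :=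
  forall x, Lam x -> eqC (l1on (stab x)) (Phi x) (Psi x).

Definition normF n (Phi : S -> ('I_n -> G -> C) -> C) : R :=
  sup [set r : R | exists x, Lam x /\ r = normC (l1on (stab x)) (Phi x)].

Definition cobF n (Phi : S -> ('I_n -> G -> C) -> C) : S -> ('I_n.+1 -> G -> C) -> C :=
  fun x => cobC (Phi x).

Definition cocycF n (Phi : S -> ('I_n -> G -> C) -> C) :=
  cochF Phi /\ eqF (cobF Phi) (fun _ _ => 0).

Definition cobndF n : (S -> ('I_n -> G -> C) -> C) -> Prop :=
  match n as n0 return (S -> ('I_n0 -> G -> C) -> C) -> Prop with
  | 0 => fun Phi => eqF Phi (fun _ _ => 0)
  | m.+1 => fun Phi => exists Psi, @cochF m Psi /\ eqF (cobF Psi) Phi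
  end.

Definition qnormF n (Phi : S -> ('I_n -> G -> C) -> C) : R :=
  inf [set r : R | exists B, @cobndF n B /\
                    r = normF (fun x a => Phi x a - B x a)].

End Group.

Definition left_action (G : groupType) (S : Type) (act : G -> S -> S) :=
  (forall s, act 1%g s = s) /\ (forall g h s, act (g * h)%g s = act g (act h s)).

Definition orbit_transversal (G : groupType) (S : Type) (act : G -> S -> S)
  (Lam : set S) :=
  (forall s, exists x, Lam x /\ exists g, act g x = s)
  /\ (forall x y g, Lam x -> Lam y -> act g x = y -> x = y).

(* A topological isomorphism between the seminormed quotient spaces           *)
(*   Z1/B1  and  Z2/B2  (cocycles modulo coboundaries, with quotient seminorms *)
(* q1, q2), presented through a map T on representatives inducing a C-linear  *)
(* bijection of the quotients which is continuous with continuous inverse     *)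
(* (for linear maps of seminormed spaces: bounded in both directions).        *)
Definition topiso (R : realType) (X Y : Type)
  (addX : X -> X -> X) (scX : R[i] -> X -> X) (subX : X -> X -> X)
  (addY : Y -> Y -> Y) (scY : R[i] -> Y -> Y) (subY : Y -> Y -> Y)
  (Z1 B1 : X -> Prop) (q1 : X -> R) (Z2 B2 : Y -> Prop) (q2 : Y -> R) :=
  exists T : X -> Y,
    [/\ forall z, Z1 z -> Z2 (T z),
        forall z w c, Z1 z -> Z1 w ->
          B2 (subY (T (addX (scX c z) w)) (addY (scY c (T z)) (T w))),
        forall z w, Z1 z -> Z1 w -> (B1 (subX z w) <-> B2 (subY (T z) (T w))),
        forall y, Z2 y -> exists2 z, Z1 z & B2 (subY (T z) y)
      & exists c1 c2 : R, forall z, Z1 z ->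
          q2 (T z) <= c1 * q1 z /\ q1 z <= c2 * q2 (T z)].

(* Main.v *)
Require Import Defs.
From mathcomp Require Import all_boot all_order all_algebra.
From mathcomp Require Import complex.
From mathcomp Require Import boolp classical_sets cardinality fsbigop.
From mathcomp Require Import reals ereal esum numfun.
From mathcomp Require Import zify ring lra.
Import Order.TTheory GRing.Theory Num.Theory.
Local Open Scope ring_scope.

Set Implicit Arguments.
Unset Strict Implicit.
Unset Printing Implicit Defensive.

(** A bounded multilinear cochain on [l^1] is determined by its values on the
    basis, so both complexes are complexes of bounded functions: on the bar
    complex of the action groupoid of [G] on [S], and on those of the isotropy
    groups [H_x]. Restricting a cochain to the vertex [delta_x] and to
    [l^1(H_x)] is a chain map of norm at most 1. Choosing for each [s] an
    element [tau s] carrying the representative [base s] to [s] gives a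
    retraction [(g, s) |-> (tau (g s))^-1 g (tau s)] of the groupoid onto its
    isotropy groups, hence a chain map of norm at most 1 in the other direction;
    the natural isomorphism [tau] yields the prism homotopy between the other
    composite and the identity. *)

(** On strings of length n the prism is a sum of n+1 terms, so its norm grows with the degree. This
    costs nothing in the quotient seminorms: the prism changes a cocycle only by a coboundary, while
    pulling back along the retraction cannot enlarge the supremum of the coefficients. The
    isomorphism therefore comes out isometric, provided the norm of a cochain is controlled by its
    values on basis tuples without any loss of constant. The choice of [tau] is normalised to 1 on
    [Lam]. The retraction then fixes every isotropy group at a point of [Lam], restriction after
    pullback is the identity on the nose, and only the other composite needs a homotopy. Because the
    right action on l^1(S) is trivial, deleting the first group element is a face that leaves the
    vertex alone; the left action enters only through the last face, which moves the vertex. A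
    cochain on the whole groupoid is bounded on all orbits at once, which is why the other side is
    an l^oo-sum and why its estimates have to be uniform in [x]. *)

Section Modulus.
Variable R : realType.
Local Notation C := R[i].
Implicit Types x y z : C.

Lemma cabsE z : cabs z = Num.sqrt (complex.Re z ^+ 2 + complex.Im z ^+ 2).
Proof. by case: z. Qed.

Lemma cabs_ge0 z : 0 <= cabs z.
Proof. by rewrite cabsE sqrtr_ge0. Qed.

Lemma cabs0 : cabs (0 : C) = 0.
Proof. exact: ComplexField.Normc.normc0. Qed.

Lemma cabs1 : cabs (1 : C) = 1.
Proof. exact: ComplexField.Normc.normc1. Qed.

Lemma cabsM x y : cabs (x * y) = cabs x * cabs y.
Proof. exact: ComplexField.Normc.normcM. Qed.

Lemma cabsD x y : cabs (x + y) <= cabs x + cabs y.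
Proof. exact: le_normcD. Qed.

Lemma cabsN x : cabs (- x) = cabs x.
Proof. exact: normcN. Qed.

Lemma cabs_eq0 x : cabs x = 0 -> x = 0.
Proof. exact: ComplexField.Normc.eq0_normc. Qed.

Lemma abs_Re_le z : `|complex.Re z| <= cabs z.
Proof. by rewrite cabsE -sqrtr_sqr ler_wsqrtr// lerDl sqr_ge0. Qed.

Lemma abs_Im_le z : `|complex.Im z| <= cabs z.
Proof. by rewrite cabsE -sqrtr_sqr ler_wsqrtr// lerDr sqr_ge0. Qed.

Lemma cabs_le_ReIm z : cabs z <= `|complex.Re z| + `|complex.Im z|.
Proof.
rewrite cabsE -[leRHS]ger0_norm ?addr_ge0// -sqrtr_sqr ler_wsqrtr//.
rewrite sqrrD !real_normK ?num_real// addrAC lerDl mulrn_wge0// mulr_ge0.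
Qed.

Lemma cabs_signr (k : nat) : cabs ((-1) ^+ k : C) = 1.
Proof. by elim: k => [|k ih]; rewrite ?expr0 ?cabs1// exprS cabsM ih cabsN cabs1 mulr1. Qed.

End Modulus.

(** * Sums of nonnegative real families *)

Section RealSum.
Variables (R : realType) (T : choiceType).
Local Open Scope ereal_scope.

Lemma esumZl (c : R) (u : T -> \bar R) : (0 <= c)%R -> (forall t, 0 <= u t) ->
  \esum_(t in [set: T]) (c%:E * u t) = c%:E * \esum_(t in [set: T]) u t.
Proof.
move=> c0 u0; rewrite /esum -ereal_supZl//; last first.
  by apply/set0P; exists (\sum_(x \in set0) u x); exists set0 => //; exact: fsets_set0.
congr ereal_sup; apply/seteqP; split=> [_ [X hX <-]|_ [_ [X hX <-] <-]].
  by exists (\sum_(x \in X) u x); [exists X|rewrite ge0_mule_fsumr].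
by exists X => //; rewrite ge0_mule_fsumr.
Qed.

Lemma esum_exchange (T' : choiceType) (u : T -> T' -> \bar R) :
  (forall i j, 0 <= u i j) ->
  \esum_(i in [set: T]) \esum_(j in [set: T']) u i j =
  \esum_(j in [set: T']) \esum_(i in [set: T]) u i j.
Proof.
move=> u0; rewrite !esum_esum//.
rewrite (@reindex_esum _ _ _ (setT `*`` (fun=> setT)) _ (fun k => (k.2, k.1)))//.
split=> //.
- by move=> [a b] [c d] _ _ [-> ->].
- by move=> [a b] _; exists (b, a).
Qed.

Definition nsum (u : T -> R) := \esum_(t in [set: T]) (u t)%:E.

Lemma nsum_ge0 u : (forall t, 0 <= u t)%R -> 0 <= nsum u.
Proof. by move=> u0; apply: esum_ge0 => t _; rewrite lee_fin. Qed.

Lemma le_nsum u v : (forall t, u t <= v t)%R -> nsum u <= nsum v.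
Proof. by move=> uv; apply: le_esum => t _; rewrite lee_fin. Qed.

Lemma nsumD u v : (forall t, 0 <= u t)%R -> (forall t, 0 <= v t)%R ->
  nsum (fun t => u t + v t)%R = nsum u + nsum v.
Proof. by move=> u0 v0; rewrite /nsum -esumD// => t _; rewrite lee_fin. Qed.

Lemma nsumZ c u : (0 <= c)%R -> (forall t, 0 <= u t)%R ->
  nsum (fun t => c * u t)%R = c%:E * nsum u.
Proof.
by move=> c0 u0; rewrite /nsum -esumZl// => t; rewrite lee_fin.
Qed.

Lemma nsum_fin u : (forall t, 0 <= u t)%R -> nsum u < +oo ->
  nsum u = (fine (nsum u))%:E.
Proof. by move=> u0 ufin; rewrite fineK// ge0_fin_numE// nsum_ge0. Qed.

Lemma nsum_single (t : T) (r : R) : (0 <= r)%R ->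
  nsum (fun u => if u == t then r else 0)%R = r%:E.
Proof.
move=> r0; rewrite /nsum -[RHS](@esum_set1 _ _ t (fun=> r%:E)) ?lee_fin//.
rewrite [RHS]esum_mkcond; apply: eq_esum => u _.
case: (eqVneq u t) => [->|/eqP ut]; first by rewrite mem_set.
by rewrite memNset.
Qed.

End RealSum.

(** * Linearity of the sum of an absolutely summable real family *)

Section RealSumLinear.
Variables (R : realType) (T : choiceType).
Implicit Types u v p q : T -> R.

Definition rl1 u := (nsum (fun t => `|u t|%R) < +oo)%E.

Lemma rl1_le u p : rl1 p -> (forall t, `|u t| <= `|p t|) -> rl1 u.
Proof. by move=> hp up; apply: le_lt_trans hp; exact: le_nsum. Qed.

Lemma rl1D u v : rl1 u -> rl1 v -> rl1 (fun t => u t + v t).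
Proof.
move=> hu hv; apply: le_lt_trans (lte_add_pinfty hu hv).
rewrite -nsumD//; apply: le_nsum => t; exact: ler_normD.
Qed.

Lemma rl1Z c u : rl1 u -> rl1 (fun t => c * u t).
Proof.
move=> hu; rewrite /rl1 (_ : (fun _ => _) = (fun t => `|c| * `|u t|)); last first.
  by apply/funext => t; rewrite normrM.
rewrite nsumZ// nsum_fin//; exact: ltry.
Qed.

Lemma rl1_pos u : rl1 u -> rl1 (fun t => Num.max (u t) 0).
Proof.
move=> /rl1_le; apply => t; case: (leP 0 (u t)) => h //.
by rewrite normr0.
Qed.

Lemma rl1_nsum p : rl1 p -> (forall t, 0 <= p t) -> (nsum p < +oo)%E.
Proof. by move=> hp p0; apply: le_lt_trans hp; apply: le_nsum => t; exact: ler_norm. Qed.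

Lemma rsumE u : rsum u = fine (nsum (fun t => Num.max (u t) 0))
  - fine (nsum (fun t => Num.max (- u t) 0)).
Proof. by []. Qed.

(** Positive and negative parts are not additive, so linearity of [rsum] cannot be read off its
    definition. This lemma lets any decomposition into nonnegative summable families replace the
    canonical one; linearity then follows by choosing a decomposition that is itself linear. *)
Lemma rsumB p q : rl1 p -> rl1 q -> (forall t, 0 <= p t) -> (forall t, 0 <= q t) ->
  rsum (fun t => p t - q t) = fine (nsum p) - fine (nsum q).
Proof.
move=> hp hq p0 q0.
set A := fun t => Num.max (p t - q t) 0; set B := fun t => Num.max (- (p t - q t)) 0.
have e : (nsum A - nsum B = nsum p - nsum q)%E.
  transitivity (\esum_(i in [set: T]) ((EFin \o p) \- (EFin \o q))^\+ i -
     \esum_(i in [set: T]) ((EFin \o p) \- (EFin \o q))^\- i)%E; last first.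
    exact: (@esumB R T setT (EFin \o p) (EFin \o q) hp hq (fun t _ => p0 t) (fun t _ => q0 t)).
  congr (_ - _)%E; apply: eq_esum => t _; rewrite ?(funeposE, funenegE).
    by rewrite EFin_max.
  by rewrite EFin_max.
have hpq : rl1 (fun t => p t - q t).
  apply: rl1D => //; apply: rl1_le hq _ => t; by rewrite normrN.
have A0 t : 0 <= A t by rewrite le_max lexx orbT.
have B0 t : 0 <= B t by rewrite le_max lexx orbT.
have hA : (nsum A < +oo)%E by apply: rl1_nsum A0; exact: rl1_pos.
have hB : (nsum B < +oo)%E.
  apply: rl1_nsum B0; apply: (@rl1_pos (fun t => - (p t - q t))).
  by apply: rl1_le hpq _ => t; rewrite normrN.
move: e; rewrite (nsum_fin A0 hA) (nsum_fin B0 hB) (nsum_fin p0 (rl1_nsum hp p0)).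
by rewrite (nsum_fin q0 (rl1_nsum hq q0)) -!EFinB => -[].
Qed.

Lemma posnegE (r : R) : r = Num.max r 0 - Num.max (- r) 0.
Proof. by case: (leP 0 r) => h; case: (leP 0 (- r)) => h'; lra. Qed.

Lemma max0_ge0 (r : R) : 0 <= Num.max r 0.
Proof. by rewrite le_max lexx orbT. Qed.

Lemma rl1_neg u : rl1 u -> rl1 (fun t => Num.max (- u t) 0).
Proof.
move=> hu; apply: (@rl1_pos (fun t => - u t)).
by apply: rl1_le hu _ => t; rewrite normrN.
Qed.

Lemma rsumD u v : rl1 u -> rl1 v -> rsum (fun t => u t + v t) = rsum u + rsum v.
Proof.
move=> hu hv.
transitivity (rsum (fun t => (Num.max (u t) 0 + Num.max (v t) 0) -
    (Num.max (- u t) 0 + Num.max (- v t) 0))).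
  congr rsum; apply/funext => t.
  by rewrite {1}(posnegE (u t)) {1}(posnegE (v t)); ring.
have [pu pv] := (rl1_pos hu, rl1_pos hv).
have [nu nv] := (rl1_neg hu, rl1_neg hv).
rewrite rsumB ?addr_ge0//; try by [exact: rl1D|move=> t; rewrite addr_ge0// max0_ge0].
rewrite !nsumD; try by move=> t; exact: max0_ge0.
rewrite !fineD ?ge0_fin_numE ?nsum_ge0//; try by [move=> t; exact: max0_ge0|
  apply: rl1_nsum => // t; exact: max0_ge0].
rewrite rsumE rsumE; ring.
Qed.

Lemma rsumN u : rsum (fun t => - u t) = - rsum u.
Proof.
by rewrite /rsum opprB; congr (_ - fine _); apply: eq_esum => t _; rewrite opprK.
Qed.

Lemma rsumZ c u : rl1 u -> rsum (fun t => c * u t) = c * rsum u.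
Proof.
move=> hu; wlog c0 : c / 0 <= c => [H|].
  have [/H//|/ltW c0] := leP 0 c.
  transitivity (rsum (fun t => - ((- c) * u t))).
    by congr rsum; apply/funext => t; ring.
  by rewrite rsumN H ?oppr_ge0//; ring.
transitivity (rsum (fun t => c * Num.max (u t) 0 - c * Num.max (- u t) 0)).
  by congr rsum; apply/funext => t; rewrite {1}(posnegE (u t)); ring.
rewrite rsumB; try by [apply: rl1Z; by [exact: rl1_pos|exact: rl1_neg]|
  move=> t; rewrite mulr_ge0// max0_ge0].
rewrite !nsumZ//; try by move=> t; exact: max0_ge0.
rewrite !fineM// ?ge0_fin_numE ?nsum_ge0//; try by [move=> t; exact: max0_ge0|
  apply: rl1_nsum; by [exact: rl1_pos|exact: rl1_neg|move=> t; exact: max0_ge0]].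
rewrite rsumE /=; ring.
Qed.

Lemma abs_rsum_le u : rl1 u -> `|rsum u| <= fine (nsum (fun t => `|u t|)).
Proof.
move=> hu; rewrite rsumE.
have [pu nu] := (rl1_pos hu, rl1_neg hu).
have -> : nsum (fun t => `|u t|) =
    (nsum (fun t => Num.max (u t) 0)%R + nsum (fun t => Num.max (- u t) 0)%R)%E.
  rewrite -nsumD; try by move=> t; exact: max0_ge0.
  congr nsum; apply/funext => t; case: (leP 0 (u t)) => h.
    by rewrite ger0_norm// ?max_r ?oppr_le0// addr0.
  by rewrite ltr0_norm// max_l ?oppr_ge0 ?ltW// add0r.
rewrite fineD ?ge0_fin_numE ?nsum_ge0//; try by [move=> t; exact: max0_ge0|
  apply: rl1_nsum => // t; exact: max0_ge0].
apply: le_trans (ler_normB _ _) _.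
by rewrite !ger0_norm ?fine_ge0 ?nsum_ge0// => t; exact: max0_ge0.
Qed.

Lemma rsum_single (t : T) (r : R) : rsum (fun u : T => if u == t then r else 0) = r.
Proof.
rewrite [RHS]posnegE /rsum; congr (_ - _).
- rewrite -[RHS]/(fine (Num.max r 0)%:E) -(nsum_single t (max0_ge0 r)).
  by congr fine; apply: eq_esum => u _; case: ifP => // _; rewrite maxxx.
- rewrite -[RHS]/(fine (Num.max (- r) 0)%:E) -(nsum_single t (max0_ge0 _)).
  by congr fine; apply: eq_esum => u _; case: ifP => // _; rewrite oppr0 maxxx.
Qed.

End RealSumLinear.

(** * The space l^1(T), its bounded functionals and their values on the basis *)

Section L1Space.
Variables (R : realType) (T : choiceType).
Local Notation C := R[i].
Implicit Types (f g : T -> C) (P : set T).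

Definition delta (t : T) : T -> C := fun u => if u == t then 1 else 0.

Lemma l1E f : l1 f = (nsum (fun t => cabs (f t)) < +oo)%E.
Proof. by []. Qed.

Lemma nsum_cabs f : l1 f -> nsum (fun t => cabs (f t)) = (l1norm f)%:E.
Proof. by move=> hf; rewrite (nsum_fin _ hf)// => t; exact: cabs_ge0. Qed.

Lemma l1norm_ge0 f : 0 <= l1norm f.
Proof. by rewrite fine_ge0// nsum_ge0// => t; exact: cabs_ge0. Qed.

Lemma l1_le_nsum f (M : R) : (nsum (fun t => cabs (f t)) <= M%:E)%E ->
  l1 f /\ l1norm f <= M.
Proof.
move=> h; have hf : l1 f by rewrite l1E (le_lt_trans h)// ltry.
by split=> //; rewrite -lee_fin -nsum_cabs.
Qed.

Lemma l1_dom f g (K : R) : l1 g -> 0 <= K ->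
  (forall t, cabs (f t) <= K * cabs (g t)) -> l1 f /\ l1norm f <= K * l1norm g.
Proof.
move=> hg K0 fg; apply: l1_le_nsum; rewrite EFinM -nsum_cabs// -nsumZ//.
  exact: le_nsum.
by move=> t; exact: cabs_ge0.
Qed.

Lemma l1_lin c f g : l1 f -> l1 g -> l1 (fun t => c * f t + g t).
Proof.
move=> hf hg.
have: (nsum (fun t => cabs c * cabs (f t) + cabs (g t))%R < +oo)%E.
  rewrite nsumD ?nsumZ ?cabs_ge0// ?nsum_cabs//; try by move=> t; exact: cabs_ge0.
    by rewrite -EFinM -EFinD ltry.
  by move=> t; rewrite mulr_ge0 ?cabs_ge0.
apply: le_lt_trans; apply: le_nsum => t; apply: le_trans (cabsD _ _) _.
by rewrite cabsM.
Qed.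

Lemma l1Z c f : l1 f -> l1 (fun t => c * f t).
Proof.
move=> hf; apply: (proj1 (l1_dom hf (cabs_ge0 c) _)) => t.
by rewrite cabsM.
Qed.

Lemma l1normZ c f : l1 f -> l1norm (fun t => c * f t) <= cabs c * l1norm f.
Proof.
move=> hf; apply: (proj2 (l1_dom hf (cabs_ge0 c) _)) => t.
by rewrite cabsM.
Qed.

Lemma l1_0 : l1 (fun _ : T => 0 : C) /\ l1norm (fun _ : T => 0 : C) <= 0.
Proof.
apply: l1_le_nsum; rewrite /nsum esum1// => t _; by rewrite cabs0.
Qed.

Lemma cabs_le_l1norm f t : l1 f -> cabs (f t) <= l1norm f.
Proof.
move=> hf; rewrite -lee_fin -nsum_cabs// -(nsum_single t (cabs_ge0 _)).
by apply: le_nsum => u; case: eqVneq => [->//|_]; exact: cabs_ge0.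
Qed.

Lemma l1_rl1_Re f : l1 f -> rl1 (fun t => complex.Re (f t)).
Proof. by apply: le_lt_trans; apply: le_nsum => t; exact: abs_Re_le. Qed.

Lemma l1_rl1_Im f : l1 f -> rl1 (fun t => complex.Im (f t)).
Proof. by apply: le_lt_trans; apply: le_nsum => t; exact: abs_Im_le. Qed.

Lemma csum_lin c f g : l1 f -> l1 g ->
  csum (fun t => c * f t + g t) = c * csum f + csum g.
Proof.
move=> hf hg; have [rf If] := (l1_rl1_Re hf, l1_rl1_Im hf).
have [rg Ig] := (l1_rl1_Re hg, l1_rl1_Im hg).
case: c => x y; rewrite /csum; apply/eqP; rewrite eq_complex; apply/andP; split; apply/eqP => /=.
- transitivity (rsum (fun t => (x * complex.Re (f t) + (- y) * complex.Im (f t)) + complex.Re (g t))).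
    by congr rsum; apply/funext => t; case: (f t) (g t) => a b [a' b'] /=; ring.
  rewrite (rsumD (rl1D (rl1Z x rf) (rl1Z (- y) If)) rg).
  rewrite (rsumD (rl1Z x rf) (rl1Z (- y) If)) (rsumZ x rf) (rsumZ (- y) If).
  by ring.
- transitivity (rsum (fun t => (x * complex.Im (f t) + y * complex.Re (f t)) + complex.Im (g t))).
    by congr rsum; apply/funext => t; case: (f t) (g t) => a b [a' b'] /=; ring.
  rewrite (rsumD (rl1D (rl1Z x If) (rl1Z y rf)) Ig).
  by rewrite (rsumD (rl1Z x If) (rl1Z y rf)) (rsumZ x If) (rsumZ y rf).
Qed.

Lemma csum_single t (z : C) : csum (fun u : T => if u == t then z else 0) = z.
Proof.
case: z => x y; apply/eqP; rewrite eq_complex; apply/andP; split; apply/eqP => /=.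
- by rewrite -[RHS](@rsum_single R T t); congr rsum; apply/funext => u; case: ifP.
- by rewrite -[RHS](@rsum_single R T t); congr rsum; apply/funext => u; case: ifP.
Qed.

Lemma csum_deltal t f : csum (fun u => delta t u * f u) = f t.
Proof.
rewrite -[RHS](csum_single t); congr csum; apply/funext => u.
by rewrite /delta; case: eqVneq => [->|_]; rewrite ?mul1r ?mul0r.
Qed.

Lemma csum_delta t : csum (delta t) = 1.
Proof. exact: csum_single. Qed.

(** Real and imaginary parts are estimated separately, whence the factor 2. It is enough to know
    that [csum] is bounded; [csum_le] then removes the factor. *)
Lemma csum_crude f : l1 f -> cabs (csum f) <= (1 + 1) * l1norm f.
Proof.
move=> hf; apply: le_trans (cabs_le_ReIm _) _; rewrite /csum /= mulrDl mul1r lerD//.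
- apply: le_trans (abs_rsum_le (l1_rl1_Re hf)) _.
  rewrite fine_le ?ge0_fin_numE ?nsum_ge0//.
  + exact: l1_rl1_Re.
  + by move=> t; exact: cabs_ge0.
  + by apply: le_nsum => t; exact: abs_Re_le.
- apply: le_trans (abs_rsum_le (l1_rl1_Im hf)) _.
  rewrite fine_le ?ge0_fin_numE ?nsum_ge0//.
  + exact: l1_rl1_Im.
  + by move=> t; exact: cabs_ge0.
  + by apply: le_nsum => t; exact: abs_Im_le.
Qed.

Lemma l1_delta t : l1 (delta t) /\ l1norm (delta t) <= 1.
Proof.
apply: l1_le_nsum; rewrite -(nsum_single t (@ler01 R)); apply: le_nsum => u.
by rewrite /delta; case: ifP; rewrite ?cabs1 ?cabs0.
Qed.

Lemma l1norm_delta t : l1norm (delta t) = 1.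
Proof.
have [h1 h2] := l1_delta t; apply/eqP; rewrite eq_le h2 /=.
by have := cabs_le_l1norm t h1; rewrite /delta eqxx cabs1.
Qed.

(** The analogue of [l1on] over an arbitrary index type; on a group the two unfold to the same
    proposition. *)
Definition l1s P f := l1 f /\ supp_in P f.

Lemma l1sT f : l1 f -> l1s [set: T] f.
Proof. by move=> hf; split=> // t /(_ I). Qed.

Lemma l1s_lin P c f g : l1s P f -> l1s P g -> l1s P (fun t => c * f t + g t).
Proof.
move=> [hf sf] [hg sg]; split; first exact: l1_lin.
by move=> t nPt; rewrite sf// sg// mulr0 addr0.
Qed.

Lemma l1s0 P : l1s P (fun=> 0).
Proof. by split=> //; exact: (proj1 l1_0). Qed.

Lemma l1s_delta P t : P t -> l1s P (delta t).
Proof.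
move=> Pt; split; first exact: (proj1 (l1_delta t)).
by move=> u nPu; rewrite /delta; case: eqVneq => // ut; case: nPu; rewrite ut.
Qed.

Definition restr (X : seq T) f : T -> C := fun t => if t \in X then f t else 0.

Lemma l1s_restr P X f : l1s P f -> l1s P (restr X f).
Proof.
move=> [hf sf]; split.
  apply: (proj1 (l1_dom hf ler01 _)) => t; rewrite mul1r /restr.
  by case: ifP => // _; rewrite cabs0 cabs_ge0.
by move=> t nPt; rewrite /restr sf// if_same.
Qed.

Lemma l1norm_restr_le X f : l1 f -> l1norm (restr X f) <= l1norm f.
Proof.
move=> hf; rewrite -[leRHS]mul1r; apply: (proj2 (l1_dom hf ler01 _)) => t.
by rewrite mul1r /restr; case: ifP => // _; rewrite cabs0 cabs_ge0.
Qed.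

Lemma l1norm_restr_cons x X f : l1 f -> x \notin X ->
  l1norm (restr (x :: X) f) = cabs (f x) + l1norm (restr X f).
Proof.
move=> hf xX; have hr Y : l1 (restr Y f) by exact: (proj1 (l1s_restr Y (l1sT hf))).
apply: EFin_inj; rewrite EFinD -!nsum_cabs// -(nsum_single x (cabs_ge0 _)) -nsumD.
- congr nsum; apply/funext => t; rewrite /restr inE.
  by case: eqVneq => [->|_] /=; [rewrite (negbTE xX) cabs0 addr0|rewrite add0r].
- by move=> t; case: ifP => // _; exact: cabs_ge0.
- by move=> t; exact: cabs_ge0.
Qed.

Lemma l1_truncate f (e : R) : l1 f -> 0 < e ->
  exists2 X : seq T, uniq X & l1norm (fun t => f t - restr X f t) <= e.
Proof.
move=> hf e0; have hfin : nsum (fun t => cabs (f t)) \is a fin_num.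
  by rewrite nsum_cabs.
have [_ [X [finX _] <-] hX] := ub_ereal_sup_adherent e0 hfin.
have /finite_seqP[r rX] := finX.
(* Without repetitions, since the induction in [lbf_bound] peels off entries that must not recur. *)
exists (undup r); first exact: undup_uniq.
have XE t : (t \in undup r) = (t \in X).
  by rewrite mem_undup rX; apply/idP/idP => [h|/set_mem//]; exact: mem_set.
apply: (proj2 (l1_le_nsum _)).
have h0 t : (0 <= (cabs (f t))%:E)%E by rewrite lee_fin cabs_ge0.
have E : (nsum (fun t => cabs (f t)) = \sum_(t \in X) (cabs (f t))%:E +
    nsum (fun t => cabs (f t - restr (undup r) f t)%R))%E.
  rewrite {1}/nsum (esumID X)// setTI; congr (_ + _)%E.
    by rewrite esum_fset.
  rewrite setTI esum_mkcond; apply: eq_esum => t _; rewrite /restr XE in_setC.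
  by case: (t \in X) => /=; rewrite ?subrr ?cabs0 ?subr0.
have sfin : (\sum_(t \in X) (cabs (f t))%:E \is a fin_num)%E.
  rewrite ge0_fin_numE.
    apply: le_lt_trans hf; rewrite -/(nsum _) E leeDl// nsum_ge0// => t.
    exact: cabs_ge0.
  by apply: fsume_ge0.
move: hX; rewrite -/(esum _ _) -/(nsum (fun t => cabs (f t))) E lteBlDr//.
by rewrite lteD2lE// => /ltW.
Qed.

Definition lbf P (phi : (T -> C) -> C) :=
  (forall f g c, l1s P f -> l1s P g ->
     phi (fun t => c * f t + g t) = c * phi f + phi g) /\
  exists M : R, forall f, l1s P f -> cabs (phi f) <= M * l1norm f.

Lemma lbf0 P phi : lbf P phi -> phi (fun=> 0) = 0.
Proof.
move=> [lin _]; have := lin _ _ 1 (l1s0 P) (l1s0 P).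
rewrite (_ : (fun t => _) = (fun=> 0)); last by apply/funext => t; rewrite mulr0 addr0.
by rewrite mul1r -{1}[phi _]addr0 => /addrI.
Qed.

(* A bounded functional is controlled on finitely supported vectors by its
   values on the basis, and these vectors are dense. *)
Lemma lbf_bound P phi (N : R) : lbf P phi -> 0 <= N ->
  (forall t, P t -> cabs (phi (delta t)) <= N) ->
  forall f, l1s P f -> cabs (phi f) <= N * l1norm f.
Proof.
move=> hphi N0 hN f hf; have [lin [M hM]] := hphi.
have fin (X : seq T) : uniq X -> cabs (phi (restr X f)) <= N * l1norm (restr X f).
  elim: X => [_|x X ih /= /andP[xX uX]].
    rewrite (_ : restr [::] f = fun=> 0)//.
    by rewrite (lbf0 hphi) cabs0 mulr_ge0 ?l1norm_ge0.
  rewrite (l1norm_restr_cons hf.1 xX) mulrDr.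
  have [Px|nPx] := pselect (P x); last first.
    rewrite (_ : restr _ f = restr X f); last first.
      apply/funext => t; rewrite /restr inE; case: eqVneq => //= ->.
      by rewrite hf.2// if_same.
    apply: le_trans (ih uX) _; rewrite lerDr mulr_ge0// cabs_ge0//.
  rewrite (_ : restr _ f = fun t => f x * delta x t + restr X f t); last first.
    apply/funext => t; rewrite /restr /delta inE; case: eqVneq => [->|_] /=.
      by rewrite (negbTE xX) mulr1 addr0.
    by rewrite mulr0 add0r.
  rewrite lin; [|exact: l1s_delta|exact: l1s_restr].
  apply: le_trans (cabsD _ _) _; rewrite lerD// ?ih//.
  by rewrite cabsM mulrC ler_wpM2r ?cabs_ge0// hN.
apply/ler_addgt0Pr => e e0.
have M0 : 0 < `|M| + 1 by rewrite ltr_pwDr.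
have [X uX hX] := l1_truncate hf.1 (divr_gt0 e0 M0).
pose g := fun t => f t - restr X f t.
have gE : g = fun t => (-1) * restr X f t + f t.
  by apply/funext => t; rewrite /g mulN1r addrC.
have hg : l1s P g by rewrite gE; apply: l1s_lin => //; exact: l1s_restr.
have -> : f = fun t => 1 * g t + restr X f t.
  by apply/funext => t; rewrite /g mul1r subrK.
rewrite {1}lin//; last exact: l1s_restr.
rewrite mul1r addrC; apply: le_trans (cabsD _ _) _; apply: lerD.
  apply: le_trans (fin _ uX) _; rewrite ler_wpM2l//.
  rewrite (_ : (fun t => _) = f); first exact: l1norm_restr_le hf.1.
  by apply/funext => t; rewrite /g mul1r subrK.
apply: le_trans (hM _ hg) _.
apply: (@le_trans _ _ ((`|M| + 1) * l1norm g)).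
  by rewrite ler_wpM2r ?l1norm_ge0// (le_trans (ler_norm _))// lerDl.
by rewrite mulrC -ler_pdivlMr.
Qed.

Lemma lbf_csum : lbf [set: T] (@csum R T).
Proof.
split=> [f g c [hf _] [hg _]|]; first exact: csum_lin.
by exists (1 + 1) => f [hf _]; exact: csum_crude.
Qed.

(** The sum takes the value 1 on every basis vector, so [lbf_bound] turns the crude estimate into
    the sharp one. *)
Lemma csum_le f : l1 f -> cabs (csum f) <= l1norm f.
Proof.
move=> hf; rewrite -[leRHS]mul1r; apply: (lbf_bound lbf_csum) => //.
  by move=> t _; rewrite csum_delta cabs1.
exact: l1sT.
Qed.

Lemma lbf_linc P phi psi c : lbf P phi -> lbf P psi ->
  lbf P (fun f => c * phi f + psi f).
Proof.
move=> [lin1 [M1 hM1]] [lin2 [M2 hM2]]; split=> [f g d hf hg|].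
  by rewrite lin1// lin2//; ring.
exists (cabs c * M1 + M2) => f hf; apply: le_trans (cabsD _ _) _.
rewrite mulrDl lerD ?hM2// cabsM -mulrA ler_wpM2l ?cabs_ge0//.
exact: hM1.
Qed.

Lemma lbf_zero P : lbf P (fun=> 0).
Proof.
split=> [f g c _ _|]; first by rewrite mulr0 addr0.
by exists 0 => f _; rewrite cabs0 mul0r.
Qed.

Lemma lbfZ P phi c : lbf P phi -> lbf P (fun f => c * phi f).
Proof.
move=> h; rewrite (_ : (fun f => _) = fun f => c * phi f + 0).
  by apply: lbf_linc => //; exact: lbf_zero.
by apply/funext => f; rewrite addr0.
Qed.

Lemma lbfD P phi psi : lbf P phi -> lbf P psi -> lbf P (fun f => phi f + psi f).
Proof.
move=> h1 h2; rewrite (_ : (fun f => _) = fun f => 1 * phi f + psi f).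
  exact: lbf_linc.
by apply/funext => f; rewrite mul1r.
Qed.

Lemma lbf_sum P n (phi : 'I_n -> (T -> C) -> C) : (forall i, lbf P (phi i)) ->
  lbf P (fun f => \sum_(i < n) phi i f).
Proof.
elim: n phi => [|n ih] phi h.
  rewrite (_ : (fun f => _) = fun=> 0); first exact: lbf_zero.
  by apply/funext => f; rewrite big_ord0.
rewrite (_ : (fun f => _) =
  fun f => phi ord0 f + \sum_(i < n) phi (lift ord0 i) f).
  by apply: lbfD => //; exact: (ih (fun i => phi (lift ord0 i))).
by apply/funext => f; rewrite big_ord_recl.
Qed.

End L1Space.

(** * Bounded linear maps between l^1 spaces, and the module actions *)

Section BoundedLinear.
Variable R : realType.
Local Notation C := R[i].

Definition blm (T U : choiceType) (P : set T) (Q : set U)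
    (L : (T -> C) -> U -> C) :=
  (forall f g c, l1s P f -> l1s P g ->
     L (fun t => c * f t + g t) = fun u => c * L f u + L g u) /\
  exists2 M : R, 0 <= M &
    forall f, l1s P f -> l1s Q (L f) /\ l1norm (L f) <= M * l1norm f.

Lemma lbf_comp (T U : choiceType) (P : set T) (Q : set U)
    (L : (T -> C) -> U -> C) phi :
  blm P Q L -> lbf Q phi -> lbf P (fun f => phi (L f)).
Proof.
move=> [linL [M M0 hM]] [lin [N hN]]; split=> [f g c hf hg|].
  by rewrite linL// lin//; apply: (proj1 (hM _ _)).
exists (`|N| * M) => f hf; have [h1 h2] := hM _ hf.
apply: le_trans (hN _ h1) _; rewrite -mulrA.
apply: (@le_trans _ _ (`|N| * l1norm (L f))).
  by rewrite ler_wpM2r ?l1norm_ge0// ler_norm.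
by rewrite ler_wpM2l.
Qed.

Section Action.
Variables (G S : choiceType).
Variables (a : G -> C) (b : G -> S -> C) (N : R).
Hypotheses (ha : l1 a) (N0 : 0 <= N).
Hypotheses (hb : forall g, l1 (b g)) (bN : forall g, l1norm (b g) <= N).

Lemma l1_mulr_bounded s : l1 (fun g => a g * b g s).
Proof.
apply: (proj1 (l1_dom ha N0 _)) => g; rewrite cabsM mulrC ler_wpM2r ?cabs_ge0//.
by apply: le_trans (bN g); exact: cabs_le_l1norm.
Qed.

(** The series of the vectors [b g] with weights [a g], evaluated coordinatewise. The modulus of
    each coordinate is bounded by an inner l^1 norm, and the two nonnegative sums are then
    exchanged. Convolution and the action on l^1(S) are both of this form. *)
Lemma l1_csum_family :
  l1 (fun s => csum (fun g => a g * b g s)) /\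
  l1norm (fun s => csum (fun g => a g * b g s)) <= l1norm a * N.
Proof.
apply: l1_le_nsum.
apply: (@le_trans _ _ (nsum (fun s => l1norm (fun g => a g * b g s)))).
  by apply: le_nsum => s; exact: csum_le (l1_mulr_bounded s).
have -> : nsum (fun s => l1norm (fun g => a g * b g s)) =
    (\esum_(s in [set: S]) \esum_(g in [set: G]) (cabs (a g * b g s))%:E)%E.
  by apply: eq_esum => s _; rewrite -nsum_cabs//; exact: l1_mulr_bounded.
rewrite esum_exchange; last by move=> s g; rewrite lee_fin cabs_ge0.
rewrite mulrC EFinM -nsum_cabs// -nsumZ//; last by move=> g; exact: cabs_ge0.
apply: le_esum => g _.
have -> : (\esum_(s in [set: S]) (cabs (a g * b g s))%:E)%E =
    nsum (fun s => cabs (a g) * cabs (b g s)).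
  by apply: eq_esum => s _; rewrite cabsM.
rewrite nsumZ ?cabs_ge0//; last by move=> s; exact: cabs_ge0.
by rewrite nsum_cabs// -EFinM lee_fin mulrC ler_wpM2r ?cabs_ge0.
Qed.

End Action.
End BoundedLinear.

Section ModuleMaps.
Variable R : realType.
Local Notation C := R[i].
Variables (G : groupType) (S : choiceType) (act : G -> S -> S).
Hypothesis Hact : left_action act.

Lemma actK g s : act g^-1%g (act g s) = s.
Proof. by rewrite -Hact.2 mulVg Hact.1. Qed.

Lemma actVK g s : act g (act g^-1%g s) = s.
Proof. by rewrite -Hact.2 mulgV Hact.1. Qed.

Lemma l1_translate g (xi : S -> C) : l1 xi ->
  l1 (fun s => xi (act g^-1%g s)) /\ l1norm (fun s => xi (act g^-1%g s)) <= l1norm xi.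
Proof.
move=> hxi; apply: l1_le_nsum; rewrite -nsum_cabs// /nsum.
rewrite (@reindex_esum R S S setT setT (act g)); last first.
  split=> //.
  - by move=> s t _ _ h; rewrite -(actK g s) h actK.
  - by move=> s _; exists (act g^-1%g s) => //; exact: actVK.
by apply: le_esum => s _; rewrite actK.
Qed.

Lemma csum0 (T : choiceType) : csum (fun _ : T => 0 : C) = 0.
Proof. exact: lbf0 (lbf_csum R T). Qed.

(** Keeping track of supports lets the same lemmas serve the full module l^1(S) and convolution
    inside a subalgebra [l1on H]. *)
Variables (P : set G) (Q Q' : set S).
Hypothesis HPQ : forall g s, P g -> Q s -> Q' (act g s).

Lemma l1s_lact a (xi : S -> C) : l1s P a -> l1s Q xi ->
  l1s Q' (lact act a xi) /\ l1norm (lact act a xi) <= l1norm a * l1norm xi.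
Proof.
move=> [ha sa] [hxi sxi].
have [h1 h2] := @l1_csum_family R G S a (fun g s => xi (act g^-1%g s)) _ ha
  (l1norm_ge0 xi) (fun g => (l1_translate g hxi).1) (fun g => (l1_translate g hxi).2).
split=> //; split=> // s nQs.
rewrite /lact (_ : (fun g => _) = fun=> 0) ?csum0//; apply/funext => g.
have [Pg|nPg] := pselect (P g); last by rewrite sa// mul0r.
by rewrite sxi ?mulr0// => Qs; apply: nQs; rewrite -(actVK g s); exact: HPQ.
Qed.

Lemma l1_lact_summand (a : G -> C) (xi : S -> C) s : l1 a -> l1 xi ->
  l1 (fun g => a g * xi (act g^-1%g s)).
Proof.
move=> ha hxi; apply: (@l1_mulr_bounded R G S a (fun g s => xi (act g^-1%g s)) _ ha
  (l1norm_ge0 xi) (fun g => (l1_translate g hxi).1) (fun g => (l1_translate g hxi).2)).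
Qed.

Lemma blm_lactl (xi : S -> C) : l1s Q xi -> blm P Q' (fun a => lact act a xi).
Proof.
move=> hxi; split=> [a b c ha hb|].
  apply/funext => s.
  rewrite /lact -(csum_lin c (l1_lact_summand s ha.1 hxi.1) (l1_lact_summand s hb.1 hxi.1)).
  by congr csum; apply/funext => g; ring.
exists (l1norm xi); first exact: l1norm_ge0.
by move=> a ha; rewrite mulrC; exact: l1s_lact.
Qed.

Lemma blm_lactr (a : G -> C) : l1s P a -> blm Q Q' (lact act a).
Proof.
move=> ha; split=> [xi eta c hxi heta|].
  apply/funext => s.
  rewrite /lact -(csum_lin c (l1_lact_summand s ha.1 hxi.1) (l1_lact_summand s ha.1 heta.1)).
  by congr csum; apply/funext => g; ring.
exists (l1norm a); first exact: l1norm_ge0.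
by move=> xi hxi; exact: l1s_lact.
Qed.

Lemma lact_delta g s : lact act (delta R g) (delta R s) = delta R (act g s).
Proof.
apply/funext => t; rewrite /lact csum_deltal /delta.
have [->|ne] := eqVneq t (act g s); first by rewrite actK eqxx.
by case: eqVneq => // h; case/eqP: ne; rewrite -h actVK.
Qed.

Lemma aug_le (a : G -> C) : l1 a -> cabs (aug a) <= l1norm a.
Proof. exact: csum_le. Qed.

Lemma ract_delta (g : G) (xi : S -> C) : ract xi (delta R g) = xi.
Proof. by apply/funext => s; rewrite /ract /aug csum_delta mulr1. Qed.

Lemma blm_ractl (a : G -> C) : blm Q Q (fun xi => ract xi a).
Proof.
split=> [xi eta c hxi heta|]; first by apply/funext => s; rewrite /ract; ring.
exists (cabs (aug a)); first exact: cabs_ge0.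
move=> xi [hxi sxi]; rewrite (_ : ract xi a = fun s => aug a * xi s).
  split; last exact: l1normZ.
  by split; [exact: l1Z|move=> s nQs; rewrite sxi// mulr0].
by apply/funext => s; rewrite /ract mulrC.
Qed.

Lemma blm_ractr (xi : S -> C) : l1s Q xi -> blm P Q (ract xi).
Proof.
move=> hxi; split=> [a b c [ha _] [hb _]|].
  by apply/funext => s; rewrite /ract /aug csum_lin//; ring.
exists (l1norm xi); first exact: l1norm_ge0.
move=> a [ha _]; rewrite (_ : ract xi a = fun s => aug a * xi s).
  split.
    by split; [exact: l1Z hxi.1|move=> s nQs; rewrite hxi.2// mulr0].
  apply: le_trans (l1normZ _ hxi.1) _; rewrite mulrC ler_wpM2l ?l1norm_ge0//.
  exact: aug_le.
by apply/funext => s; rewrite /ract mulrC.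
Qed.

End ModuleMaps.

Section Convolution.
Variable R : realType.
Local Notation C := R[i].
Variables (G : groupType) (P : set G).
Hypothesis PM : forall g h, P g -> P h -> P (g * h)%g.

(** [conv] is [lact] for the action of the group on itself by left translation, so its properties
    are instances of those of the module action. *)
Lemma left_action_mul : left_action (fun g h : G => (g * h)%g).
Proof. by split=> [g|g h k]; rewrite ?mul1g ?mulgA. Qed.

Lemma l1s_conv (a b : G -> C) : l1s P a -> l1s P b -> l1s P (conv a b).
Proof. by move=> ha hb; exact: (l1s_lact left_action_mul PM ha hb).1. Qed.

Lemma blm_convl (b : G -> C) : l1s P b -> blm P P (fun a => conv a b).
Proof. exact: (blm_lactl left_action_mul PM). Qed.

Lemma blm_convr (a : G -> C) : l1s P a -> blm P P (conv a).
Proof. exact: (blm_lactr left_action_mul PM). Qed.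

Lemma conv_delta (g h : G) : conv (delta R g) (delta R h) = delta R (g * h)%g.
Proof. exact: (lact_delta R left_action_mul). Qed.

End Convolution.

(** * Separately bounded multilinear maps and their values on basis tuples *)

Section Multilinear.
Variable R : realType.
Local Notation C := R[i].
Variable G : groupType.
Implicit Types (P : set G) (l : seq G).

(* Separate boundedness suffices for determination by basis values, and unlike a
   product bound it passes through the coboundary formula one argument at a time. *)
Definition smulti P n (psi : ('I_n -> G -> C) -> C) :=
  forall (a : 'I_n -> G -> C) i, (forall j, l1s P (a j)) ->
    lbf P (fun v => psi (cupd a i v)).

(** Lists are used so that the bar complex can recurse on them. The default 1 belongs to every
    subgroup, so a list that is too short still gives a tuple in l^1(H), and bounds on coefficients
    need no condition on the length. *)
Definition bvec n l : 'I_n -> G -> C := fun i => delta R (nth 1%g l i).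

Lemma cupd_id n (a : 'I_n -> G -> C) i : cupd a i (a i) = a.
Proof. by apply/funext => j; rewrite /cupd; case: eqVneq => [->|]. Qed.

Lemma cupd_same n (a : 'I_n -> G -> C) i v : cupd a i v i = v.
Proof. by rewrite /cupd eqxx. Qed.

Lemma cupd_cupd n (a : 'I_n -> G -> C) i v w : cupd (cupd a i v) i w = cupd a i w.
Proof. by apply/funext => j; rewrite /cupd; case: eqVneq. Qed.

Lemma l1s_cupd P n (a : 'I_n -> G -> C) i v : (forall j, l1s P (a j)) -> l1s P v ->
  forall j, l1s P (cupd a i v j).
Proof. by move=> ha hv j; rewrite /cupd; case: eqP. Qed.

Lemma smulti_of_lin P n (psi : ('I_n -> G -> C) -> C) (M : R) :
  multilinC (l1on P) psi ->
  (forall a, (forall j, l1s P (a j)) -> cabs (psi a) <= M * \prod_(j < n) l1norm (a j)) ->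
  smulti P psi.
Proof.
move=> lin hM a i ha; split=> [v w c hv hw|].
  have := lin (cupd a i v) i w c (l1s_cupd i ha hv) hw.
  by rewrite !cupd_cupd cupd_same.
exists (M * \prod_(j < n | j != i) l1norm (a j)) => v hv.
apply: le_trans (hM _ (l1s_cupd i ha hv)) _.
rewrite (bigD1 i)//= cupd_same mulrCA mulrC (eq_bigr (fun j => l1norm (a j)))//.
by move=> j /negbTE ji; rewrite /cupd ji.
Qed.

(** The constants in [smulti] may depend on the other arguments, but [lbf_bound] discards them.
    Applied one slot at a time it yields a joint bound with the same constant as on basis tuples. *)
Lemma smulti_bound P n (psi : ('I_n -> G -> C) -> C) (N : R) :
  smulti P psi -> 0 <= N ->
  (forall l, size l = n -> (forall g, g \in l -> P g) -> cabs (psi (bvec l)) <= N) ->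
  forall a, (forall j, l1s P (a j)) -> cabs (psi a) <= N * \prod_(j < n) l1norm (a j).
Proof.
move=> hpsi N0 hN.
(* [k] counts the slots already freed: those of index at least [k] still hold basis vectors. *)
suff H k : forall a : 'I_n -> G -> C, (forall j, l1s P (a j)) ->
    (forall j : 'I_n, (k <= j)%N -> exists2 g, P g & a j = delta R g) ->
    cabs (psi a) <= N * \prod_(j < n) l1norm (a j).
  by move=> a ha; apply: (H n) => // j; rewrite leqNgt ltn_ord.
elim: k => [|k ih] a ha hd.
  have [g hg] := choice (fun j => (fun p => let: ex_intro2 g h1 h2 := p in
    ex_intro (fun g => P g /\ a j = delta R g) g (conj h1 h2)) (hd j (leq0n j))).
  have -> : a = bvec (codom g).
    apply/funext => j; rewrite (hg j).2 /bvec; congr delta.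
    by rewrite (nth_map j) ?size_enum_ord// nth_ord_enum.
  rewrite big1 => [|j _]; last exact: l1norm_delta.
  rewrite mulr1; apply: hN; first by rewrite size_codom card_ord.
  by move=> x /codomP[j ->]; exact: (hg j).1.
have [kn|nk] := ltnP k n; last first.
  by apply: ih => // j kj; have := ltn_ord j; lia.
pose i := Ordinal kn.
rewrite -{1}(cupd_id a i) (bigD1 i)//= mulrCA mulrC.
apply: (lbf_bound (hpsi a i ha)) => //.
  by rewrite mulr_ge0// prodr_ge0// => j _; exact: l1norm_ge0.
move=> t Pt; have hc := l1s_cupd i ha (l1s_delta R Pt).
apply: le_trans (ih _ hc _) _.
  move=> j kj; rewrite /cupd; case: eqVneq => [_|ji]; first by exists t.
  apply: hd; rewrite ltn_neqAle kj andbT; apply: contraNneq ji => kj'.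
  by apply/eqP/val_inj.
rewrite (bigD1 i)//= cupd_same l1norm_delta mul1r.
rewrite (eq_bigr (fun j => l1norm (a j)))//.
by move=> j /negbTE ji; rewrite /cupd ji.
Qed.

Lemma smulti_sum P n m (psi : 'I_m -> ('I_n -> G -> C) -> C) :
  (forall k, smulti P (psi k)) -> smulti P (fun a => \sum_(k < m) psi k a).
Proof. by move=> h a i ha; apply: lbf_sum => k; exact: h. Qed.

Lemma smultiZ P n c (psi : ('I_n -> G -> C) -> C) :
  smulti P psi -> smulti P (fun a => c * psi a).
Proof. by move=> h a i ha; apply: lbfZ; exact: h. Qed.

Lemma smultiD P n (psi phi : ('I_n -> G -> C) -> C) :
  smulti P psi -> smulti P phi -> smulti P (fun a => psi a + phi a).
Proof. by move=> h1 h2 a i ha; apply: lbfD; [exact: h1|exact: h2]. Qed.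

Lemma ctail_cupd0 n (a : 'I_n.+1 -> G -> C) v : ctail (cupd a ord0 v) = ctail a.
Proof. by apply/funext. Qed.

Lemma ctail_cupdS n (a : 'I_n.+1 -> G -> C) i v :
  ctail (cupd a (lift ord0 i) v) = cupd (ctail a) i v.
Proof. by apply/funext => j; rewrite /ctail /cupd (inj_eq lift_inj). Qed.

Lemma cupdS0 n (a : 'I_n.+1 -> G -> C) i v : cupd a (lift ord0 i) v ord0 = a ord0.
Proof. by []. Qed.

(** The shape of the first term of the coboundary: the first argument acts on the module vector, the
    others enter the cochain. [smulti_last] is the same for the last term. *)
Lemma smulti_head P n (L : (G -> C) -> ('I_n -> G -> C) -> C) :
  (forall v, l1s P v -> smulti P (L v)) ->
  (forall w, (forall j, l1s P (w j)) -> lbf P (L ^~ w)) ->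
  smulti P (fun a => L (a ord0) (ctail a)).
Proof.
move=> h1 h2 a i ha; have [j ->|->] := unliftP ord0 i.
  rewrite (_ : (fun v => _) = fun v => L (a ord0) (cupd (ctail a) j v)).
    by apply: h1 => //; move=> k; exact: ha.
  by apply/funext => v; rewrite ctail_cupdS.
rewrite (_ : (fun v => _) = fun v => L v (ctail a)).
  by apply: h2 => k; exact: ha.
by apply/funext => v; rewrite ctail_cupd0 cupd_same.
Qed.

Lemma smulti_last P n (L : (G -> C) -> ('I_n -> G -> C) -> C) :
  (forall v, l1s P v -> smulti P (L v)) ->
  (forall w, (forall j, l1s P (w j)) -> lbf P (L ^~ w)) ->
  smulti P (fun a => L (a ord_max) (cinit a)).
Proof.
move=> h1 h2 a i ha; have [j ->|->] := unliftP ord_max i.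
  have -> : lift ord_max j = widen_ord (leqnSn n) j.
    by apply: val_inj; rewrite /= /bump leqNgt ltn_ord.
  rewrite (_ : (fun v => _) = fun v => L (a ord_max) (cupd (cinit a) j v)).
    by apply: h1 => //; move=> k; exact: ha.
  apply/funext => v.
  have -> : cupd a (widen_ord (leqnSn n) j) v ord_max = a ord_max.
    by rewrite /cupd -val_eqE /= gtn_eqF.
  have -> // : cinit (cupd a (widen_ord (leqnSn n) j) v) = cupd (cinit a) j v.
  by apply/funext => k; rewrite /cinit /cupd -!val_eqE.
rewrite (_ : (fun v => _) = fun v => L v (cinit a)).
  by apply: h2 => k; exact: ha.
apply/funext => v; rewrite cupd_same.
have -> // : cinit (cupd a ord_max v) = cinit a.
by apply/funext => k; rewrite /cinit /cupd -val_eqE /= ltn_eqF.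
Qed.

(** Changing one slot changes exactly one slot of the merged tuple. The four cases are a slot before
    the merged pair, its left factor, its right factor, and a slot after it, whose index drops by
    one. *)
Lemma smulti_merge P n (psi : ('I_n -> G -> C) -> C) (j : 'I_n) :
  (forall g h, P g -> P h -> P (g * h)%g) ->
  smulti P psi -> smulti P (fun a => psi (cmerge a j)).
Proof.
move=> PM h a i ha.
have hm k : l1s P (cmerge a j k).
  by rewrite /cmerge; do 2 case: ifP => // _; apply: l1s_conv.
have [ij|ij] := ltnP i j.
  have hi : (i < n)%N by apply: ltn_trans ij _.
  rewrite (_ : (fun v => _) = fun v => psi (cupd (cmerge a j) (Ordinal hi) v)); first exact: h.
  apply/funext => v; congr psi; apply/funext => k.
  rewrite /cmerge /cupd -!val_eqE /= /bump /=.
  by do ! (case: ifP => //=; move=> ?); exfalso; lia.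
have [ij'|ij'] := eqVneq (i : nat) j.
  rewrite (_ : (fun v => _) =
    fun v => psi (cupd (cmerge a j) j (conv v (a (lift ord0 j))))).
    exact: (lbf_comp (blm_convl PM (ha _)) (h _ j hm)).
  apply/funext => v; congr psi; apply/funext => k.
  rewrite /cmerge /cupd -!val_eqE /= /bump /=.
  do ! (case: ifP => //=; move=> ?); try by exfalso; lia.
  by congr (conv v (a _)); apply: val_inj; rewrite /= /bump /=; lia.
have [ij2|ij2] := eqVneq (i : nat) j.+1.
  rewrite (_ : (fun v => _) =
    fun v => psi (cupd (cmerge a j) j (conv (a (widen_ord (leqnSn n) j)) v))).
    exact: (lbf_comp (blm_convr PM (ha _)) (h _ j hm)).
  apply/funext => v; congr psi; apply/funext => k.
  rewrite /cmerge /cupd -!val_eqE /= /bump /=.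
  do ! (case: ifP => //=; move=> ?); try by exfalso; lia.
  by congr (conv (a _) v); apply: val_inj; rewrite /=; lia.
have hi : (i.-1 < n)%N by have := ltn_ord i; have := ltn_ord j; lia.
rewrite (_ : (fun v => _) = fun v => psi (cupd (cmerge a j) (Ordinal hi) v)); first exact: h.
apply/funext => v; congr psi; apply/funext => k.
rewrite /cmerge /cupd -!val_eqE /= /bump /=.
by do ! (case: ifP => //=; move=> ?); exfalso; lia.
Qed.

End Multilinear.

(** * The bar complex of the action groupoid, its retraction and the prism homotopy *)

Section BarComplex.
Variables (V : comNzRingType) (G : groupType) (S : Type) (act : G -> S -> S).
Implicit Types (F : seq G -> S -> V) (l : seq G).

(* All faces of the bar coboundary except the one that deletes the head. *)
Fixpoint bar_tail F l s : V :=
  match l with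
  | [::] => 0
  | g :: l1 => match l1 with
               | [::] => - F [::] (act g s)
               | h :: l2 => - F ((g * h)%g :: l2) s - bar_tail (fun k => F (g :: k)) l1 s
               end
  end.

(** A list at [s] is a string of composable arrows starting at [s], its last entry applied first.
    The face deleting the head is split off because it is not compatible with the recursion of
    [bar_tail], which fixes the head [g] and passes to the cochain [k |-> F (g :: k)]. *)
Definition bar F l s : V := F (behead l) s + bar_tail F l s.

Lemma bar_tail_cons2 F g h l s : bar_tail F (g :: h :: l) s =
  - F ((g * h)%g :: l) s - bar_tail (fun k => F (g :: k)) (h :: l) s.
Proof. by []. Qed.

Lemma bar_tailB F F' l s :
  bar_tail (fun k t => F k t - F' k t) l s = bar_tail F l s - bar_tail F' l s.
Proof.
elim: l F F' => [|g [|h l] ih] F F'; first by rewrite subr0.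
  by rewrite /=; ring.
by rewrite !bar_tail_cons2 ih; ring.
Qed.

Lemma barB F F' l s : bar (fun k t => F k t - F' k t) l s = bar F l s - bar F' l s.
Proof. by rewrite /bar bar_tailB; ring. Qed.

Lemma eq_bar_tail F F' l s :
  (forall k t, size k = (size l).-1 -> F k t = F' k t) ->
  bar_tail F l s = bar_tail F' l s.
Proof.
elim: l F F' => [//|g [|h l] ih] F F' e; first by rewrite /= e.
by rewrite !bar_tail_cons2 e// (ih _ (fun k => F' (g :: k)))// => k t hk; rewrite e//= hk.
Qed.

(** The length condition is needed because the coefficients of [ext F] are known only on lists of
    the right length. *)
Lemma eq_bar n F F' l s : size l = n.+1 ->
  (forall k t, size k = n -> F k t = F' k t) -> bar F l s = bar F' l s.
Proof.
move=> hl e; rewrite /bar e ?size_behead ?hl//; congr (_ + _).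
by apply: eq_bar_tail => k t hk; rewrite e// hk hl.
Qed.

Fixpoint merge_at (j : nat) l : seq G :=
  match l with
  | g :: l1 => match l1 with
               | h :: l2 => if j is i.+1 then g :: merge_at i l1 else (g * h)%g :: l2
               | [::] => l
               end
  | [::] => l
  end.

Lemma nth_merge_at j l i : (j.+1 < size l)%N ->
  nth 1%g (merge_at j l) i =
  if (i < j)%N then nth 1%g l i
  else if i == j then (nth 1%g l i * nth 1%g l i.+1)%g else nth 1%g l i.+1.
Proof.
elim: l j i => [//|g [//|h l] ih] [|j] [|i] hj //.
by rewrite -[LHS]/(nth 1%g (merge_at j (h :: l)) i) ih.
Qed.

(** The recursive form suits the homotopy; this alternating sum is the form in which Hochschild
    coboundaries are recognised. *)
Lemma bar_tailE n F l s : size l = n.+1 ->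
  bar_tail F l s = \sum_(j < n) (-1) ^+ j.+1 * F (merge_at j l) s
    + (-1) ^+ n.+1 * F (take n l) (act (last 1%g l) s).
Proof.
elim: n l F => [|n ih] [//|g [|h l]] F // hl.
  by rewrite big_ord0 add0r expr1 mulN1r.
rewrite bar_tail_cons2 (ih (h :: l)); last by case: hl => <-.
rewrite big_ord_recl /= expr1 mulN1r -addrA; congr (_ + _).
rewrite opprD -sumrN; congr (_ + _); last by rewrite [in RHS]exprS mulN1r mulNr.
by apply: eq_bigr => j _; rewrite /bump /= add1n [in RHS]exprS mulN1r mulNr.
Qed.

Section Retraction.
Variables (base : S -> S) (tau : S -> G).
Hypothesis Hact : left_action act.
Hypothesis tau_base : forall s, act (tau s) (base s) = s.
Hypothesis base_act : forall g s, base (act g s) = base s.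

(* [(g, s) |-> (ret g s, base s)] retracts the action groupoid onto the isotropy
   groups of the points [base s]; [tau] is a natural isomorphism from this
   retraction to the identity. *)
Definition ret g s : G := ((tau (act g s))^-1 * g * tau s)%g.

Definition lact_seq l s := foldr act s l.

Fixpoint ret_seq l s : seq G :=
  if l is g :: k then ret g (lact_seq k s) :: ret_seq k s else [::].

Definition pullback F l s : V := F (ret_seq l s) (base s).

(** The alternating sum, over the vertices of the string, of the strings that keep the arrows to the
    left of the vertex, insert [tau] there, and retract the arrows to the right. The recursion
    removes the leftmost arrow, as in [bar_tail]. *)
Fixpoint prism F l s : V :=
  match l with
  | [::] => F [:: tau s] (base s)
  | g :: k => F (tau (lact_seq l s) :: ret_seq l s) (base s)
              - prism (fun k => F (g :: k)) k s
  end.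

Lemma act_ret g s : act (ret g s) (base s) = base s.
Proof.
have e : act g s = act (tau (act g s)) (base s) by rewrite -{1}(tau_base (act g s)) base_act.
rewrite /ret !Hact.2 tau_base; move: e; set u := tau _ => ->.
by rewrite -Hact.2 mulVg Hact.1.
Qed.

Lemma base_lact_seq l s : base (lact_seq l s) = base s.
Proof. by elim: l => //= g l ih; rewrite base_act. Qed.

Lemma size_ret_seq l s : size (ret_seq l s) = size l.
Proof. by elim: l => //= g l ->. Qed.

Lemma ret_seq_stab l s g : g \in ret_seq l s -> act g (base s) = base s.
Proof.
elim: l => //= h l ih; rewrite inE => /orP[/eqP->|/ih//].
by rewrite -(base_lact_seq l) act_ret.
Qed.

Lemma retM g h s : ret (g * h)%g s = (ret g (act h s) * ret h s)%g.
Proof. by rewrite /ret Hact.2 !mulgA mulgK. Qed.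

Lemma tau_ret g s : (tau (act g s) * ret g s)%g = (g * tau s)%g.
Proof. by rewrite /ret !mulgA mulgV mul1g. Qed.

Lemma ret_seq_mul g h l s : ret_seq ((g * h)%g :: l) s =
  (ret g (lact_seq (h :: l) s) * ret h (lact_seq l s))%g :: ret_seq l s.
Proof. by rewrite /= retM. Qed.

(** Only deletion of the head changes the endpoint [lact_seq l s] of a string; all faces in
    [bar_tail] keep it, so [A] may depend on it. The induction needs this parameter, since the
    retraction of a fixed head depends on where the rest of the string ends, and so does the term of
    the prism with [tau] at the endpoint. *)
Lemma bar_tail_pull (A : S -> seq G -> S -> V) l s :
  bar_tail (fun k t => A (lact_seq k t) (ret_seq k t) (base t)) l s =
  bar_tail (A (lact_seq l s)) (ret_seq l s) (base s).
Proof.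
elim: l A => [//|g [|h l] ih] A; first by rewrite /= base_act act_ret.
have e : ret_seq (g :: h :: l) s =
  ret g (lact_seq (h :: l) s) :: ret h (lact_seq l s) :: ret_seq l s by [].
rewrite e !bar_tail_cons2 ret_seq_mul.
have -> : lact_seq ((g * h)%g :: l) s = lact_seq (g :: h :: l) s by rewrite /= Hact.2.
congr (- _ - _).
exact: (ih (fun t k b => A (act g t) (ret g t :: k) b)).
Qed.

Lemma bar_pull F l s : bar (pullback F) l s = pullback (bar F) l s.
Proof.
rewrite /bar /pullback; congr (_ + _); first by case: l.
exact: (bar_tail_pull (fun=> F)).
Qed.

Lemma prismB F F' l s :
  prism (fun k t => F k t - F' k t) l s = prism F l s - prism F' l s.
Proof.
elim: l F F' => [//|g l ih] F F'.
by rewrite /= (ih (fun k => F (g :: k)) (fun k => F' (g :: k))); ring.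
Qed.

(** The homotopy identity without the faces that delete the head, in which form it is stable under
    [F |-> fun k => F (g :: k)] and can be proved by induction on the string. The pullback is absent
    because it arises from deleting the leading [tau]. *)
Lemma prism_tail F g l s :
  bar_tail F (tau (lact_seq (g :: l) s) :: ret_seq (g :: l) s) (base s)
  - prism (fun k => bar_tail F (g :: k)) l s + bar_tail (prism F) (g :: l) s
  = - F (g :: l) s.
Proof.
elim: l g F => [|h l ih] g F.
  by rewrite /= tau_ret act_ret tau_base base_act; ring.
set t := lact_seq (h :: l) s.
(* By naturality of [tau], the face of [e1] that merges [tau] with the retracted [g] equals the face
   of [e2] that merges [g] with [tau t], so they cancel. The other terms of [e1], [e2] and [e3]
   cancel in pairs too, except those of the identity for [h :: l] and the cochain
   [fun k => F (g :: k)]. *)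
have e1 : bar_tail F (tau (lact_seq (g :: h :: l) s) :: ret_seq (g :: h :: l) s) (base s)
  = - F ((g * tau t)%g :: ret_seq (h :: l) s) (base s)
    + F (tau (act g t) :: (ret g t * ret h (lact_seq l s))%g :: ret_seq l s) (base s)
    + bar_tail (fun k => F (tau (act g t) :: ret g t :: k)) (ret_seq (h :: l) s) (base s).
  have -> : tau (lact_seq (g :: h :: l) s) :: ret_seq (g :: h :: l) s =
    tau (act g t) :: ret g t :: ret h (lact_seq l s) :: ret_seq l s by [].
  rewrite bar_tail_cons2 bar_tail_cons2 tau_ret.
  have -> : ret_seq (h :: l) s = ret h (lact_seq l s) :: ret_seq l s by [].
  by ring.
have e2 : prism (fun k => bar_tail F (g :: k)) (h :: l) s
  = - F ((g * tau t)%g :: ret_seq (h :: l) s) (base s)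
    - bar_tail (fun k => F (g :: k)) (tau t :: ret_seq (h :: l) s) (base s)
    + prism (fun k => F ((g * h)%g :: k)) l s
    + prism (fun k => bar_tail (fun k => F (g :: k)) (h :: k)) l s.
  (* [prismB] splits differences, so the negated face is written as a difference from the zero
     cochain. *)
  have -> : prism (fun k => bar_tail F (g :: k)) (h :: l) s =
    bar_tail F (g :: tau t :: ret_seq (h :: l) s) (base s)
    - prism (fun k t => (fun k t => 0 - F ((g * h)%g :: k) t) k t -
         bar_tail (fun k => F (g :: k)) (h :: k) t) l s.
    congr (_ - prism _ _ _); apply/funext => k; apply/funext => u.
    by rewrite bar_tail_cons2 sub0r.
  rewrite prismB (prismB (fun _ _ => 0)) bar_tail_cons2.
  have -> : prism (fun _ _ => 0) l s = 0.
    by elim: (l) => //= a k ->; rewrite subr0.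
  by ring.
have e3 : bar_tail (prism F) (g :: h :: l) s
  = - F (tau (act g t) :: (ret g t * ret h (lact_seq l s))%g :: ret_seq l s) (base s)
    + prism (fun k => F ((g * h)%g :: k)) l s
    - bar_tail (fun k => F (tau (act g t) :: ret g t :: k)) (ret_seq (h :: l) s) (base s)
    + bar_tail (prism (fun k => F (g :: k))) (h :: l) s.
  rewrite bar_tail_cons2.
  have -> : (fun k => prism F (g :: k)) = fun k u =>
     F (tau (act g (lact_seq k u)) :: ret g (lact_seq k u) :: ret_seq k u) (base u)
     - prism (fun k => F (g :: k)) k u by [].
  rewrite bar_tailB.
  rewrite (bar_tail_pull (fun t k b => F (tau (act g t) :: ret g t :: k) b)).
  rewrite [prism F _ _]/= -/(ret_seq _ _) -/(lact_seq _ _) retM Hact.2 -/t.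
  by ring.
rewrite e1 e2 e3 -(ih h (fun k => F (g :: k))) -/t.
by ring.
Qed.

Lemma prism_homotopy F g l s :
  prism (bar F) (g :: l) s + bar (prism F) (g :: l) s = pullback F (g :: l) s - F (g :: l) s.
Proof.
rewrite -[- F _ _]prism_tail.
have -> : prism (bar F) (g :: l) s = bar F (tau (lact_seq (g :: l) s) :: ret_seq (g :: l) s) (base s)
  - prism (fun k => bar F (g :: k)) l s by [].
have -> : (fun k => bar F (g :: k)) =
    (fun k t => F k t - (fun k t => 0 - bar_tail F (g :: k) t) k t).
  by apply/funext => k; apply/funext => t; rewrite sub0r opprK.
rewrite prismB (prismB (fun _ _ => 0)).
have -> : prism (fun _ _ => 0) l s = 0.
  by elim: (l) => //= a k ->; rewrite subr0.
rewrite /bar /pullback [behead _]/= [behead (g :: l)]/=.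
by ring.
Qed.

(** Degree 0 stands apart: there are no cochains of degree -1, and on the empty list [bar] returns
    the value of its argument instead of 0. *)
Lemma prism_homotopy0 F s : prism (bar F) [::] s = pullback F [::] s - F [::] s.
Proof. by rewrite /prism /bar /pullback /= tau_base. Qed.

Lemma prism_eq0 n F l s : size l = n -> (forall k t, size k = n.+1 -> F k t = 0) ->
  prism F l s = 0.
Proof.
elim: l n F => [|g l ih] n F /= <- F0; first by rewrite F0.
rewrite F0 ?size_ret_seq//= ?size_ret_seq// (ih (size l)) ?subr0// => k t hk.
by rewrite F0//= hk.
Qed.

End Retraction.

End BarComplex.

(** * Coefficients of cochains and of their coboundaries *)

Section Coboundaries.
Variable R : realType.
Local Notation C := R[i].
Variables (G : groupType) (S : choiceType) (act : G -> S -> S).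
Hypothesis Hact : left_action act.
Implicit Types (P : set G) (l : seq G).

Local Notation cochainD n := (('I_n -> G -> C) -> (S -> C) -> C).
Local Notation cochainC n := (('I_n -> G -> C) -> C).

Definition bcoefC n (psi : cochainC n) l : C := psi (bvec R l).
Definition bcoefD n (Psi : cochainD n) l s : C := Psi (bvec R l) (delta R s).

Lemma ctail_bvec n l : ctail (bvec R (n := n.+1) l) = bvec R (behead l).
Proof. by apply/funext => i; rewrite /ctail /bvec nth_behead lift0. Qed.

Lemma cmerge_bvec n l (j : 'I_n) : size l = n.+1 ->
  cmerge (bvec R l) j = bvec R (merge_at j l).
Proof.
move=> hl; apply/funext => i; rewrite /cmerge /bvec nth_merge_at; last first.
  by rewrite hl ltnS ltn_ord.
rewrite -val_eqE /= conv_delta /bump /= add1n.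
by case: ltngtP.
Qed.

Lemma cinit_bvec n l : size l = n.+1 ->
  cinit (bvec R (n := n.+1) l) = bvec R (take n l).
Proof. by move=> hl; apply/funext => i; rewrite /cinit /bvec nth_take. Qed.

Lemma bvec_last n l : size l = n.+1 ->
  bvec R (n := n.+1) l ord_max = delta R (last 1%g l).
Proof. by move=> hl; rewrite /bvec -nth_last hl. Qed.

Lemma l1s_bvec P n l : P 1%g -> (forall g, g \in l -> P g) ->
  forall j, l1s P (bvec R (n := n) l j).
Proof.
move=> P1 hP j; apply: l1s_delta.
have [jl|lj] := ltnP j (size l); first by apply: hP; exact: mem_nth.
by rewrite nth_default.
Qed.

Lemma l1_bvec n l j : l1 (bvec R (n := n) l j).
Proof. by exact: (l1_delta R _).1. Qed.

Lemma bcoefD_cob n (Psi : cochainD n) l s : size l = n.+1 ->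
  bcoefD (cobD act Psi) l s = bar act (bcoefD Psi) l s.
Proof.
move=> hl; rewrite /bcoefD /cobD /bar (bar_tailE _ _ _ hl) addrA.
rewrite ctail_bvec ract_delta bvec_last// lact_delta// cinit_bvec//.
by congr (_ + _ + _); apply: eq_bigr => j _; rewrite cmerge_bvec.
Qed.

(** Arrows of the isotropy group at [x] do not move [x] in the last face. Hence the complex of the
    isotropy group with trivial coefficients is the part of the groupoid bar complex at the vertex
    [x], and one operator [bar] serves both sides. *)
Lemma bcoefC_cob n (psi : S -> cochainC n) l x : size l = n.+1 ->
  (forall g, g \in l -> act g x = x) ->
  bcoefC (cobC (psi x)) l = bar act (fun k y => bcoefC (psi y) k) l x.
Proof.
move=> hl hx; rewrite /bcoefC /cobC /bar (bar_tailE _ _ _ hl) addrA.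
rewrite ctail_bvec bvec_last// cinit_bvec// /aug {1}/bvec !csum_delta mul1r mulr1.
rewrite hx; last first.
  by case: l hl {hx} => // g l _; exact: (mem_last g l).
by congr (_ + _ + _); apply: eq_bigr => j _; rewrite cmerge_bvec.
Qed.

Lemma bound_bar (F : seq G -> S -> C) (M : R) n l s : size l = n.+1 ->
  (forall k t, cabs (F k t) <= M) -> cabs (bar act F l s) <= n.+2%:R * M.
Proof.
move=> hl hF; rewrite /bar.
have -> : n.+2%:R * M = M + n.+1%:R * M by rewrite -[n.+2]add1n natrD mulrDl mul1r.
apply: le_trans (cabsD _ _) _; apply: lerD => //.
elim: n l F hl hF => [|n ih] [//|g [|h l]] F // hl hF.
  by rewrite /= cabsN mul1r.
rewrite bar_tail_cons2; apply: le_trans (cabsD _ _) _.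
have -> : n.+2%:R * M = M + n.+1%:R * M by rewrite -[n.+2]add1n natrD mulrDl mul1r.
apply: lerD; first by rewrite cabsN.
by rewrite cabsN; apply: ih => //; case: hl => <-.
Qed.

(** The counterpart of [smulti] for curried cochains, with the module vector as one more slot. *)
Definition smulti_dual n (Psi : cochainD n) :=
  (forall xi, l1 xi -> smulti [set: G] (Psi ^~ xi)) /\
  (forall a, (forall j, l1 (a j)) -> lbf [set: S] (Psi a)).

Lemma cochD_smulti n (Psi : cochainD n) : cochD Psi -> smulti_dual Psi.
Proof.
move=> [[lin1 lin2] [M hM]]; split=> [xi hxi|a ha].
  apply: (@smulti_of_lin R G _ n _ (M * l1norm xi)).
    move=> a i b c ha hb; apply: lin1 => //; first by move=> j; exact: (ha j).1.
    exact: hb.1.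
  by move=> a ha; rewrite mulrAC; apply: hM => // j; exact: (ha j).1.
split=> [xi eta c [hxi _] [heta _]|]; first exact: lin2.
by exists (M * \prod_(j < n) l1norm (a j)) => xi [hxi _]; exact: hM.
Qed.

Lemma cobD_smulti n (Psi : cochainD n) : smulti_dual Psi -> smulti_dual (cobD act Psi).
Proof.
move=> [h1 h2]; split=> [xi hxi|a ha].
  have hxi' := l1sT hxi.
  apply: smultiD; first apply: smultiD.
  - apply: (@smulti_head R G _ n (fun v w => Psi w (ract xi v))) => [v hv|w hw].
      by have [_ [M _ hM]] := blm_ractl [set: S] v; apply: h1; exact: (hM _ hxi').1.1.
    apply: (lbf_comp (blm_ractr _ hxi')).
    by apply: h2 => j; exact: (hw j).1.
  - apply: smulti_sum => j; apply: smultiZ.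
    exact: (@smulti_merge R G [set: G] n (Psi ^~ xi) j (fun _ _ _ _ => I) (h1 _ hxi)).
  - apply: smultiZ; apply: (@smulti_last R G _ n (fun v w => Psi w (lact act v xi))) => [v hv|w hw].
      by apply: h1; exact: (l1s_lact Hact (Q' := [set: S]) (fun _ _ _ _ => I) hv hxi').1.1.
    apply: (lbf_comp (blm_lactl Hact (Q' := [set: S]) (fun _ _ _ _ => I) hxi')).
    by apply: h2 => j; exact: (hw j).1.
have hT j := l1sT (ha j).
apply: lbfD; first apply: lbfD.
- by apply: (lbf_comp (blm_ractl _ _)); apply: h2 => j; exact: ha.
- apply: lbf_sum => j; apply: lbfZ; apply: h2 => k.
  rewrite /cmerge; do 2 case: ifP => // _.
  by apply: (l1s_conv (P := [set: G]) (fun _ _ _ _ => I) _ _).1; exact: hT.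
- apply: lbfZ; apply: (lbf_comp (blm_lactr Hact (Q' := [set: S]) (fun _ _ _ _ => I) (hT _))).
  by apply: h2 => j; exact: ha.
Qed.

Lemma smulti_dualB n (Psi Phi : cochainD n) : smulti_dual Psi -> smulti_dual Phi ->
  smulti_dual (fun a xi => Psi a xi - Phi a xi).
Proof.
move=> [h1 h2] [k1 k2]; split=> [xi hxi|a ha].
  rewrite (_ : (fun a => _) = fun a => Psi a xi + (-1) * Phi a xi).
    by apply: smultiD; [exact: h1|apply: smultiZ; exact: k1].
  by apply/funext => a; rewrite mulN1r.
rewrite (_ : (fun xi => _) = fun xi => Psi a xi + (-1) * Phi a xi).
  by apply: lbfD; [exact: h2|apply: lbfZ; exact: k2].
by apply/funext => xi; rewrite mulN1r.
Qed.

Lemma smulti_dual_bound n (Psi : cochainD n) (N : R) : smulti_dual Psi -> 0 <= N ->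
  (forall l s, size l = n -> cabs (bcoefD Psi l s) <= N) ->
  forall a xi, (forall j, l1 (a j)) -> l1 xi ->
  cabs (Psi a xi) <= N * (\prod_(j < n) l1norm (a j)) * l1norm xi.
Proof.
move=> [h1 h2] N0 hN a xi ha hxi; rewrite mulrAC.
apply: (smulti_bound (h1 _ hxi)); first by rewrite mulr_ge0// l1norm_ge0.
  move=> l hl _; apply: (lbf_bound (h2 _ (l1_bvec l))) => //; last exact: l1sT.
  by move=> s _; exact: hN.
by move=> j; exact: l1sT.
Qed.

(** The bound with constant 0, applied to the difference. *)
Lemma smulti_dual_eq n (Psi Phi : cochainD n) : smulti_dual Psi -> smulti_dual Phi ->
  (forall l s, size l = n -> bcoefD Psi l s = bcoefD Phi l s) -> eqD Psi Phi.
Proof.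
move=> h1 h2 e a xi ha hxi; apply/eqP; rewrite -subr_eq0; apply/eqP/cabs_eq0.
apply/eqP; rewrite eq_le cabs_ge0 andbT.
have := smulti_dual_bound (smulti_dualB h1 h2) (lexx 0) _ ha hxi.
rewrite !mul0r; apply => l s hl.
by rewrite /bcoefD -/(bcoefD Psi l s) -/(bcoefD Phi l s) e// subrr cabs0.
Qed.

Lemma smulti_eq P n (psi phi : cochainC n) : smulti P psi -> smulti P phi ->
  (forall l, size l = n -> (forall g, g \in l -> P g) -> bcoefC psi l = bcoefC phi l) ->
  Defs.eqC (l1on P) psi phi.
Proof.
move=> h1 h2 e a ha; apply/eqP; rewrite -subr_eq0; apply/eqP/cabs_eq0.
apply/eqP; rewrite eq_le cabs_ge0 andbT.
have h : smulti P (fun a => psi a + (-1) * phi a).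
  by apply: smultiD => //; exact: smultiZ.
have := smulti_bound h (lexx 0) _ ha.
rewrite mul0r mulN1r; apply => l hl hP.
by rewrite -/(bcoefC psi l) -/(bcoefC phi l) e// mulN1r subrr cabs0.
Qed.

(* The cochain with coefficients [F], summed one variable at a time. *)
Fixpoint ext n : (seq G -> S -> C) -> cochainD n :=
  match n return (seq G -> S -> C) -> cochainD n with
  | 0 => fun F a xi => csum (fun s => xi s * F [::] s)
  | m.+1 => fun F a xi =>
      csum (fun g => a ord0 g * ext (fun l => F (g :: l)) (ctail a) xi)
  end.

Lemma l1_mulr_cst (T : choiceType) (f u : T -> C) (K : R) : l1 f -> 0 <= K ->
  (forall t, cabs (u t) <= K) ->
  l1 (fun t => f t * u t) /\ l1norm (fun t => f t * u t) <= K * l1norm f.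
Proof.
move=> hf K0 hu; apply: l1_dom => // t.
by rewrite cabsM mulrC ler_wpM2r ?cabs_ge0.
Qed.

Lemma ext_bound n (F : seq G -> S -> C) (N : R) : 0 <= N ->
  (forall l s, size l = n -> cabs (F l s) <= N) ->
  forall (a : 'I_n -> G -> C) xi, (forall j, l1 (a j)) -> l1 xi ->
  cabs (ext F a xi) <= N * (\prod_(j < n) l1norm (a j)) * l1norm xi.
Proof.
move=> N0; elim: n F => [|n ih] F hF a xi ha hxi.
  rewrite big_ord0 mulr1 /=.
  have [h1 h2] := l1_mulr_cst hxi N0 (fun s => hF [::] s erefl).
  by apply: le_trans h2; exact: csum_le.
rewrite big_ord_recl /=.
have hg g : cabs (ext (fun l => F (g :: l)) (ctail a) xi) <=
    N * (\prod_(j < n) l1norm (a (lift ord0 j))) * l1norm xi.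
  apply: ih => // [l s hl|j]; last exact: ha.
  by apply: hF; rewrite /= hl.
have K0 : 0 <= N * (\prod_(j < n) l1norm (a (lift ord0 j))) * l1norm xi.
  by rewrite !mulr_ge0 ?l1norm_ge0// prodr_ge0// => j _; exact: l1norm_ge0.
have [h1 h2] := l1_mulr_cst (ha ord0) K0 hg.
apply: le_trans (csum_le h1) _; apply: le_trans h2 _.
by rewrite le_eqVlt; apply/orP; left; apply/eqP; ring.
Qed.

Lemma ext_l1 n (F : seq G -> S -> C) (N : R) : 0 <= N ->
  (forall l s, size l = n.+1 -> cabs (F l s) <= N) ->
  forall (v : G -> C) (a : 'I_n -> G -> C) xi, l1 v -> (forall j, l1 (a j)) -> l1 xi ->
  l1 (fun g => v g * ext (fun l => F (g :: l)) a xi).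
Proof.
move=> N0 hF v a xi hv ha hxi.
have K0 : 0 <= N * (\prod_(j < n) l1norm (a j)) * l1norm xi.
  by rewrite !mulr_ge0 ?l1norm_ge0// prodr_ge0// => j _; exact: l1norm_ge0.
apply: (l1_mulr_cst hv K0 _).1 => g; apply: ext_bound => // l s hl.
by apply: hF; rewrite /= hl.
Qed.

Lemma ext_multilin n (F : seq G -> S -> C) (N : R) : 0 <= N ->
  (forall l s, size l = n -> cabs (F l s) <= N) -> multilinD (ext (n := n) F).
Proof.
move=> N0; elim: n F => [|n ih] F hF.
  split=> [a [] //|a xi eta c _ hxi heta] /=.
  have [h1 _] := l1_mulr_cst hxi N0 (fun s => hF [::] s erefl).
  have [h2 _] := l1_mulr_cst heta N0 (fun s => hF [::] s erefl).
  rewrite -(csum_lin c h1 h2); congr csum; apply/funext => s; ring.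
have hFg g l s : size l = n -> cabs (F (g :: l) s) <= N by move=> hl; rewrite hF//= hl.
split=> [a i b c xi ha hb hxi|a xi eta c ha hxi heta].
  have ha' j : l1 (ctail a j) by exact: ha.
  have [j ->|->] := unliftP ord0 i; last first.
    rewrite /= !ctail_cupd0 !cupd_same.
    rewrite -(csum_lin c (ext_l1 N0 hF (ha ord0) ha' hxi) (ext_l1 N0 hF hb ha' hxi)).
    by congr csum; apply/funext => g; rewrite /cadd /cscale; ring.
  rewrite /= !ctail_cupdS !cupdS0.
  have hc k : l1 (cupd (ctail a) j b k) by rewrite /cupd; case: eqP.
  rewrite -(csum_lin c (ext_l1 N0 hF (ha ord0) ha' hxi) (ext_l1 N0 hF (ha ord0) hc hxi)).
  congr csum; apply/funext => g.
  by rewrite ((ih _ (hFg g)).1 (ctail a) j b c xi)//; ring.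
have ha' j : l1 (ctail a j) by exact: ha.
rewrite /= -(csum_lin c (ext_l1 N0 hF (ha ord0) ha' hxi) (ext_l1 N0 hF (ha ord0) ha' heta)).
congr csum; apply/funext => g.
by rewrite ((ih _ (hFg g)).2 (ctail a) xi eta c)//; ring.
Qed.

Lemma ext_cochD n (F : seq G -> S -> C) (N : R) : 0 <= N ->
  (forall l s, size l = n -> cabs (F l s) <= N) -> cochD (ext (n := n) F).
Proof.
move=> N0 hF; split; first exact: ext_multilin hF.
by exists N; exact: ext_bound.
Qed.

Lemma bcoefD_ext n (F : seq G -> S -> C) l s : size l = n ->
  bcoefD (ext (n := n) F) l s = F l s.
Proof.
elim: n F l => [|n ih] F [|g l] // hl; first by rewrite /bcoefD /= csum_deltal.
rewrite /bcoefD /= {1}/bvec /= csum_deltal ctail_bvec /= -/(bcoefD _ l s).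
by apply: ih; case: hl.
Qed.

End Coboundaries.

(** * Suprema, infima and the norms of cochains *)

Section SupInf.
Variable R : realType.
Implicit Types E F : set R.

Lemma sup_nneg E : (forall r, E r -> 0 <= r) -> 0 <= sup E.
Proof.
(* By convention [sup] is 0 on a set that is empty or unbounded above. *)
move=> E0; have [hE|nE] := pselect (has_sup E); last by rewrite sup_out.
have [[r Er] ubE] := hE.
by apply: le_trans (E0 _ Er) _; exact: ub_le_sup.
Qed.

(** How quotient seminorms are compared: each representative of one class is matched by a
    representative of the other that is no larger. *)
Lemma inf_le_inf E F : (exists r, F r) -> (forall r, E r -> 0 <= r) ->
  (forall r, F r -> exists2 r', E r' & r' <= r) -> inf E <= inf F.
Proof.
move=> F0 E0 EF; apply: lb_le_inf => // r /EF[r' Er' r'r].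
by apply: le_trans r'r; apply: ge_inf => //; exists 0 => q; exact: E0.
Qed.

Lemma cabs_sum n (f : 'I_n -> R[i]) (M : R) : (forall j, cabs (f j) <= M) ->
  cabs (\sum_(j < n) f j) <= n%:R * M.
Proof.
elim: n f => [|n ih] f hf; first by rewrite big_ord0 cabs0 mul0r.
have -> : n.+1%:R * M = M + n%:R * M by rewrite -[n.+1]add1n natrD mulrDl mul1r.
rewrite big_ord_recl.
by apply: le_trans (cabsD _ _) _; rewrite lerD// ih.
Qed.

End SupInf.

Section CochainNorms.
Variable R : realType.
Local Notation C := R[i].
Variables (G : groupType) (S : choiceType).
Implicit Types (P : set G).

Definition unit_ball P n (a : 'I_n -> G -> C) :=
  forall j, l1s P (a j) /\ l1norm (a j) <= 1.

Lemma unit_ball0 P n : unit_ball P (fun _ : 'I_n => fun=> 0).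
Proof.
by move=> j; split; [exact: l1s0|exact: le_trans (l1_0 R G).2 ler01].
Qed.

Lemma unit_ball_bvec P n l : P 1%g -> (forall g, g \in l -> P g) ->
  unit_ball P (bvec R (n := n) l).
Proof. by move=> P1 hP j; split; [exact: l1s_bvec|rewrite l1norm_delta]. Qed.

Lemma unit_ball_prod P n (a : 'I_n -> G -> C) : unit_ball P a ->
  0 <= \prod_(j < n) l1norm (a j) <= 1.
Proof.
move=> ha; apply/andP; split; first by apply: prodr_ge0 => j _; exact: l1norm_ge0.
apply: prodr_ile1 => j _; by rewrite l1norm_ge0 (ha j).2.
Qed.

Lemma normC_ge0 P n (psi : ('I_n -> G -> C) -> C) : 0 <= normC (l1on P) psi.
Proof. by apply: sup_nneg => r [a [_ ->]]; exact: cabs_ge0. Qed.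

Lemma normC_le P n (psi : ('I_n -> G -> C) -> C) (N : R) :
  (forall a, unit_ball P a -> cabs (psi a) <= N) -> normC (l1on P) psi <= N.
Proof.
move=> h; apply: ge_sup => [|r [a [ha ->]]]; last exact: h.
exists (cabs (psi (fun _ => fun=> 0))), (fun _ => fun=> 0); split=> //.
exact: unit_ball0.
Qed.

(** Some bound [N] must be known beforehand, since the norm of an unbounded map would be the
    conventional value 0. The same holds for [le_normD] and [le_normF]. *)
Lemma le_normC P n (psi : ('I_n -> G -> C) -> C) (N : R) :
  (forall a, unit_ball P a -> cabs (psi a) <= N) ->
  forall a, unit_ball P a -> cabs (psi a) <= normC (l1on P) psi.
Proof.
move=> h a ha; apply: ub_le_sup; last by exists a.
by exists N => r [b [hb ->]]; exact: h.
Qed.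

Lemma boundedC_unit P n (psi : ('I_n -> G -> C) -> C) : boundedC (l1on P) psi ->
  exists N, forall a, unit_ball P a -> cabs (psi a) <= N.
Proof.
move=> [M hM]; exists `|M| => a ha; have /andP[p0 p1] := unit_ball_prod ha.
apply: le_trans (hM _ (fun j => (ha j).1)) _; apply: le_trans (ler_norm _) _.
by rewrite normrM (ger0_norm p0) ler_piMr.
Qed.

Lemma normD_le n (Psi : ('I_n -> G -> C) -> (S -> C) -> C) (N : R) :
  (forall a xi, unit_ball [set: G] a -> l1 xi -> l1norm xi <= 1 ->
     cabs (Psi a xi) <= N) -> normD Psi <= N.
Proof.
move=> h; apply: ge_sup => [|r [a [xi [ha hxi hxi1 ->]]]].
  exists (cabs (Psi (fun _ => fun=> 0) (fun=> 0))), (fun _ => fun=> 0), (fun=> 0).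
  have [h0 h01] := l1_0 R S; split=> //; last exact: le_trans h01 ler01.
  by move=> j; have [h0' h01'] := l1_0 R G; split=> //; exact: le_trans h01' ler01.
by apply: h => // j; split; [apply: l1sT; exact: (ha j).1|exact: (ha j).2].
Qed.

Lemma le_normD n (Psi : ('I_n -> G -> C) -> (S -> C) -> C) (N : R) :
  (forall a xi, unit_ball [set: G] a -> l1 xi -> l1norm xi <= 1 ->
     cabs (Psi a xi) <= N) ->
  forall a xi, unit_ball [set: G] a -> l1 xi -> l1norm xi <= 1 ->
  cabs (Psi a xi) <= normD Psi.
Proof.
move=> h a xi ha hxi hxi1; apply: ub_le_sup.
  exists N => r [b [eta [hb heta heta1 ->]]].
  by apply: h => // j; split; [apply: l1sT; exact: (hb j).1|exact: (hb j).2].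
exists a, xi; split=> // j; split; [exact: (ha j).1.1|exact: (ha j).2].
Qed.

Lemma normD_ge0 n (Psi : ('I_n -> G -> C) -> (S -> C) -> C) : 0 <= normD Psi.
Proof. by apply: sup_nneg => r [a [xi [_ _ _ ->]]]; exact: cabs_ge0. Qed.

Lemma unit_ball_sub P Q n (a : 'I_n -> G -> C) : (forall g, P g -> Q g) ->
  unit_ball P a -> unit_ball Q a.
Proof.
move=> PQ ha j; have [[h1 h2] h3] := ha j; split=> //; split=> // g nQ.
by apply: h2 => /PQ.
Qed.

Lemma unit_ball_cmerge P n (a : 'I_n.+1 -> G -> C) j :
  (forall g h, P g -> P h -> P (g * h)%g) -> unit_ball P a -> unit_ball P (cmerge a j).
Proof.
move=> PM ha i; rewrite /cmerge; do 2 case: ifP => // _.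
have [h1 h2] := (ha (widen_ord (leqnSn n) i), ha (lift ord0 i)).
have [k1 k2] := l1s_lact (left_action_mul G) PM h1.1 h2.1.
split=> //; apply: le_trans k2 _.
by rewrite mulr_ile1 ?l1norm_ge0 ?h1.2 ?h2.2.
Qed.

(** The bound, with one [M] for each of the n+2 terms, does not depend on [P]; this makes it uniform
    over the isotropy groups in [cobndF_unit]. *)
Lemma cobC_unit P n (psi : ('I_n -> G -> C) -> C) (M : R) :
  (forall g h, P g -> P h -> P (g * h)%g) ->
  (forall a, unit_ball P a -> cabs (psi a) <= M) ->
  forall a, unit_ball P a -> cabs (cobC psi a) <= M + n%:R * M + M.
Proof.
move=> PM h a ha.
have haug j : cabs (aug (a j)) <= 1.
  by apply: le_trans (aug_le (ha j).1.1) _; exact: (ha j).2.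
have M0 : 0 <= M by exact: le_trans (cabs_ge0 _) (h _ (@unit_ball0 P n)).
have ht : cabs (psi (ctail a)) <= M by apply: h => j; exact: ha.
have hi : cabs (psi (cinit a)) <= M by apply: h => j; exact: ha.
apply: le_trans (cabsD _ _) _; apply: lerD.
  apply: le_trans (cabsD _ _) _; apply: lerD.
    by rewrite cabsM -[M]mul1r ler_pM ?cabs_ge0.
  apply: cabs_sum => j; rewrite cabsM cabs_signr mul1r; apply: h.
  exact: unit_ball_cmerge.
by rewrite cabsM cabs_signr mul1r cabsM -[M]mulr1 ler_pM ?cabs_ge0.
Qed.

Variable Lam : set S.
Variable act : G -> S -> S.

Lemma le_normF n (Phi : S -> ('I_n -> G -> C) -> C) (N : R) :
  (forall x a, Lam x -> unit_ball (stab act x) a -> cabs (Phi x a) <= N) ->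
  forall x a, Lam x -> unit_ball (stab act x) a -> cabs (Phi x a) <= normF act Lam Phi.
Proof.
move=> h x a Lx ha.
apply: (@le_trans _ _ (normC (l1on (stab act x)) (Phi x))).
  by apply: (le_normC (N := N)) => // b hb; exact: h.
apply: ub_le_sup; last by exists x.
by exists N => r [y [Ly ->]]; apply: normC_le => b hb; exact: h.
Qed.

Lemma normF_ge0 n (Phi : S -> ('I_n -> G -> C) -> C) : 0 <= normF act Lam Phi.
Proof. by apply: sup_nneg => r [x [_ ->]]; exact: normC_ge0. Qed.

Lemma normF_le n (Phi : S -> ('I_n -> G -> C) -> C) (N : R) : 0 <= N ->
  (forall x a, Lam x -> unit_ball (stab act x) a -> cabs (Phi x a) <= N) ->
  normF act Lam Phi <= N.
Proof.
move=> N0 h; have [[x Lx]|nL] := pselect (exists x, Lam x).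
  apply: ge_sup => [|r [y [Ly ->]]]; first by exists (normC (l1on (stab act x)) (Phi x)), x.
  by apply: normC_le => a; exact: h.
(* If [Lam] is empty, the norm is the supremum of the empty set, that is 0, and the bound holds by
   [0 <= N]. *)
rewrite /normF (_ : mkset _ = classical_sets.set0) ?sup0//.
by apply/seteqP; split=> // r [x [Lx _]]; apply: nL; exists x.
Qed.

End CochainNorms.

(** * Comparison of the two complexes by restriction and pullback *)

Section Shapiro.
Variable R : realType.
Local Notation C := R[i].
Variables (G : groupType) (S : choiceType) (act : G -> S -> S).
Hypothesis Hact : left_action act.
Variable Lam : set S.

Local Notation cochainD n := (('I_n -> G -> C) -> (S -> C) -> C).
Local Notation cochainC n := (('I_n -> G -> C) -> C).
Local Notation cochainF n := (S -> ('I_n -> G -> C) -> C).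

Lemma stab1 x : stab act x 1%g.
Proof. exact: Hact.1. Qed.

Lemma stabM x g h : stab act x g -> stab act x h -> stab act x (g * h)%g.
Proof. by rewrite /stab /= Hact.2 => hg hh; rewrite hh. Qed.

Definition restrict n (z : cochainD n) : cochainF n := fun x a => z a (delta R x).

Lemma cochD_unit n (z : cochainD n) : cochD z ->
  exists2 M : R, 0 <= M & forall a xi, unit_ball [set: G] a -> l1 xi -> l1norm xi <= 1 ->
    cabs (z a xi) <= M.
Proof.
move=> [_ [M hM]]; exists `|M| => // a xi ha hxi hxi1.
apply: le_trans (hM a xi (fun j => (ha j).1.1) hxi) _.
have /andP[p0 p1] := unit_ball_prod ha.
apply: le_trans (ler_norm _) _.
rewrite !normrM (ger0_norm p0) (ger0_norm (l1norm_ge0 xi)) -mulrA ler_piMr//.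
by rewrite mulr_ile1 ?l1norm_ge0.
Qed.

Lemma bcoefD_le n (z : cochainD n) (M : R) :
  (forall a xi, unit_ball [set: G] a -> l1 xi -> l1norm xi <= 1 -> cabs (z a xi) <= M) ->
  forall l s, cabs (bcoefD z l s) <= M.
Proof.
move=> h l s; apply: h; last by rewrite l1norm_delta.
  exact: unit_ball_bvec.
exact: (l1_delta R s).1.
Qed.

Lemma restrict_cochF n (z : cochainD n) : cochD z -> cochF act Lam (restrict z).
Proof.
move=> hz; have [M M0 hM] := cochD_unit hz; split=> [x Lx|].
  split=> [a i b c ha hb|].
    apply: hz.1.1; [by move=> j; exact: (ha j).1|exact: hb.1|exact: (l1_delta R x).1].
  have [_ [N hN]] := hz; exists N => a ha.
  have := hN a (delta R x) (fun j => (ha j).1) (l1_delta R x).1.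
  by rewrite l1norm_delta mulr1.
exists M => x Lx; apply: normC_le => a ha; apply: hM.
- by apply: unit_ball_sub ha.
- exact: (l1_delta R x).1.
- by rewrite l1norm_delta.
Qed.

Lemma lbf_scale (T : choiceType) (P : set T) (phi : (T -> C) -> C) c f :
  lbf P phi -> l1s P f -> phi (fun t => c * f t) = c * phi f.
Proof.
move=> h hf; rewrite -[RHS]addr0 -(lbf0 h) -h.1//; last exact: l1s0.
by congr phi; apply/funext => t; rewrite addr0.
Qed.

(** The isotropy group fixes [delta R x], so this vector spans a copy of the augmentation module.
    This is the origin of the trivial coefficients and the reason why restriction commutes with the
    coboundaries. *)
Lemma lact_delta_stab x (a : G -> C) : l1s (stab act x) a ->
  lact act a (delta R x) = fun s => aug a * delta R x s.
Proof.
move=> [ha sa]; apply/funext => s; rewrite /lact {2}/delta.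
have [->|sx] := eqVneq s x.
  rewrite mulr1 /aug; congr csum; apply/funext => g.
  have [hg|/sa ->] := pselect (stab act x g); last by rewrite mul0r.
  by rewrite /delta -{1}hg actK// eqxx mulr1.
rewrite mulr0 (_ : (fun g => _) = fun=> 0) ?csum0//; apply/funext => g.
have [hg|/sa ->] := pselect (stab act x g); last by rewrite mul0r.
rewrite /delta; case: eqVneq => [e|_]; last by rewrite mulr0.
by case/eqP: sx; rewrite -(actVK Hact g s) e hg.
Qed.

Lemma cobC_restrict n (z : cochainD n) x a : smulti_dual z ->
  (forall j, l1s (stab act x) (a j)) ->
  cobC (restrict z x) a = cobD act z a (delta R x).
Proof.
move=> [_ hz] ha; have hd := l1sT (l1_delta R x).1.
have ht := hz (ctail a) (fun j => (ha _).1).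
have hi := hz (cinit a) (fun j => (ha _).1).
rewrite /cobC /cobD /restrict (lact_delta_stab (ha ord_max)).
rewrite (_ : ract _ _ = fun s => aug (a ord0) * delta R x s); last first.
  by apply/funext => s; rewrite /ract mulrC.
by rewrite (lbf_scale _ ht hd) (lbf_scale _ hi hd) [_ * aug (a ord_max)]mulrC.
Qed.

Lemma restrict_cocycF n (z : cochainD n) : cocycD act z -> cocycF act Lam (restrict z).
Proof.
move=> [hz cz]; split; first exact: restrict_cochF.
move=> x Lx a ha; rewrite /cobF cobC_restrict//; last exact: cochD_smulti.
by apply: cz; [move=> j; exact: (ha j).1|exact: (l1_delta R x).1].
Qed.

Lemma restrict_cobndF n (B : cochainD n) : cobndD act B -> cobndF act Lam (restrict B).
Proof.
case: n B => [|n] B /=.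
  by move=> h x Lx a ha; apply: h; [case|exact: (l1_delta R x).1].
move=> [Phi [hPhi e]]; exists (restrict Phi); split; first exact: restrict_cochF.
move=> x Lx a ha; rewrite /cobF cobC_restrict//; last exact: cochD_smulti.
by apply: e; [move=> j; exact: (ha j).1|exact: (l1_delta R x).1].
Qed.

(** Turns an equality of cochains into an equality of classes; linearity of the restriction map and
    its surjectivity already hold at the level of cochains. *)
Lemma cobndF_eq0 n (B : cochainF n) : eqF act Lam B (fun _ _ => 0) -> cobndF act Lam B.
Proof.
case: n B => [|n] B //= h; exists (fun _ _ => 0); split.
  split=> [x Lx|].
    split=> [a i b c _ _|]; first by rewrite mulr0 addr0.
    by exists 0 => a _; rewrite cabs0 mul0r.
  by exists 0 => x Lx; apply: normC_le => a _; rewrite cabs0.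
move=> x Lx a ha; rewrite h// /cobF /cobC !mulr0 mul0r mulr0 add0r addr0.
by rewrite big1// => j _; rewrite mulr0.
Qed.

Lemma cobndD_eq n (B B' : cochainD n) : eqD B B' -> cobndD act B' -> cobndD act B.
Proof.
case: n B B' => [|n] B B' e /=; first by move=> h a xi ha hxi; rewrite e// h.
by move=> [Phi [hPhi h]]; exists Phi; split=> // a xi ha hxi; rewrite h// e.
Qed.

Lemma smulti_dual_0 n : @smulti_dual R G S n (fun _ _ => 0).
Proof. by split=> [xi _ a i _|a _]; exact: lbf_zero. Qed.

Lemma cobndD_0 n : @cobndD R G S act n (fun _ _ => 0).
Proof.
case: n => [|n] //=; exists (fun _ _ => 0); split.
  split; first split=> *; try by rewrite mulr0 addr0.
  by exists 0 => a xi _ _; rewrite cabs0 !mul0r.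
move=> a xi _ _; rewrite /cobD mulr0 addr0 add0r.
by rewrite big1// => j _; rewrite mulr0.
Qed.

(** [cobndD] does not ask [B] itself to be a cochain, so the bound that [le_normD] requires is
    recovered from a primitive: its coboundary has n+2 faces. *)
Lemma cobndD_unit n (B : cochainD n) : cobndD act B ->
  exists N : R, forall a xi, unit_ball [set: G] a -> l1 xi -> l1norm xi <= 1 ->
    cabs (B a xi) <= N.
Proof.
case: n B => [|n] B /=.
  by move=> h; exists 0 => a xi ha hxi _; rewrite h ?cabs0// => -[].
move=> [Phi [hPhi e]]; have [M M0 hM] := cochD_unit hPhi.
have hP := cobD_smulti Hact (cochD_smulti hPhi).
have N0 : 0 <= n.+2%:R * M by rewrite mulr_ge0.
exists (n.+2%:R * M) => a xi ha hxi hxi1.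
have ha' j := (ha j).1.1.
rewrite -e//; apply: le_trans (smulti_dual_bound hP N0 _ ha' hxi) _.
  move=> l s hl; rewrite bcoefD_cob//; apply: bound_bar => // k t.
  exact: bcoefD_le hM k t.
have /andP[p0 p1] := unit_ball_prod ha.
by rewrite -mulrA ler_piMr// mulr_ile1 ?l1norm_ge0.
Qed.

Lemma cobndF_unit n (B : cochainF n) : cobndF act Lam B ->
  exists N : R, forall x a, Lam x -> unit_ball (stab act x) a -> cabs (B x a) <= N.
Proof.
case: n B => [|n] B /=.
  by move=> h; exists 0 => x a Lx ha; rewrite h ?cabs0// => -[].
move=> [Psi [[hPsi [M hM]] e]]; exists (M + n%:R * M + M) => x a Lx ha.
rewrite -e//; last by move=> j; exact: (ha j).1.
apply: (cobC_unit (@stabM x)) => // b hb.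
have [N hN] := boundedC_unit (hPsi x Lx).2.
by apply: le_trans (hM x Lx); exact: le_normC hN _ hb.
Qed.

Variables (base : S -> S) (tau : S -> G).
Hypothesis tau_base : forall s, act (tau s) (base s) = s.
Hypothesis base_act : forall g s, base (act g s) = base s.
Hypothesis Lam_base : forall s, Lam (base s).

Local Notation pull := (pullback act base tau).
Local Notation ret_seq := (ret_seq act tau).
Local Notation prism := (prism act base tau).

Definition bcoefF n (Phi : cochainF n) l x : C := bcoefC (Phi x) l.

Lemma pull_bcoefF_le n (Phi : cochainF n) (M : R) :
  (forall x a, Lam x -> unit_ball (stab act x) a -> cabs (Phi x a) <= M) ->
  forall l s, cabs (pull (bcoefF Phi) l s) <= M.
Proof.
move=> h l s; apply: h => //; apply: unit_ball_bvec; first exact: stab1.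
exact: (ret_seq_stab Hact tau_base base_act).
Qed.

Lemma cochF_unit n (Phi : cochainF n) : cochF act Lam Phi ->
  exists2 M : R, 0 <= M &
    forall x a, Lam x -> unit_ball (stab act x) a -> cabs (Phi x a) <= M.
Proof.
move=> [hPhi [M hM]]; exists `|M| => // x a Lx ha.
have [N hN] := boundedC_unit (hPhi x Lx).2.
apply: le_trans (ler_norm M); apply: le_trans (hM x Lx).
exact: le_normC hN _ ha.
Qed.

Lemma prism_le (F : seq G -> S -> C) (M : R) : (forall l s, cabs (F l s) <= M) ->
  forall l s, cabs (prism F l s) <= (size l).+1%:R * M.
Proof.
move=> h l; elim: l F h => [|g l ih] F h s; first by rewrite /= mul1r.
rewrite [size _]/= -[X in X%:R](add1n) natrD mulrDl mul1r.
apply: le_trans (cabsD _ _) _; rewrite cabsN lerD//.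
by apply: ih => k t; exact: h.
Qed.

(* Modulo coboundaries a cocycle is the pullback of its restriction, and the
   pullback does not increase norms. *)
Lemma restrict_modulo_cobnd n (z : cochainD n) (B' : cochainF n) (M : R) : 0 <= M -> smulti_dual z ->
  (forall l s, cabs (bcoefD z l s) <= M) ->
  (forall l s, size l = n.+1 -> bar act (bcoefD z) l s = 0) ->
  cobndF act Lam B' ->
  exists B, [/\ cobndD act B, smulti_dual B &
    forall l s, size l = n -> bcoefD (fun a xi => z a xi - B a xi) l s =
      pull (bcoefF (fun x a => restrict z x a - B' x a)) l s].
Proof.
move=> M0; case: n z B' => [|n] z B' hz hM cz.
  move=> hB'; exists (fun _ _ => 0); split; [exact: (@cobndD_0 0)|exact: smulti_dual_0|].
  move=> [|//] s _; rewrite /bcoefD subr0.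
  (* In degree 0 nothing is subtracted: the homotopy identity says that a cocycle equals its
     pullback. *)
  have := prism_homotopy0 tau_base (bcoefD z) s; rewrite /= cz// => /esym/eqP.
  rewrite subr_eq0 /pullback /bcoefF /bcoefC hB' ?subr0//; last by case.
  by rewrite /restrict => /eqP.
move=> [Psi [hPsi e]]; have [N N0 hN] := cochF_unit hPsi.
(* For a cocycle [z] the homotopy gives [bar (prism z) = pull z - z], and
   [bar (pull Psi) = pull B']. Hence [bar F = pull B' - pull z + z], and subtracting it from [z]
   leaves [pull z - pull B']. *)
pose F l s := pull (bcoefF Psi) l s - prism (bcoefD z) l s.
have hF l s : size l = n -> cabs (F l s) <= N + n.+1%:R * M.
  move=> hl; apply: le_trans (cabsD _ _) _; rewrite cabsN; apply: lerD.
    exact: pull_bcoefF_le.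
  by have := prism_le hM l s; rewrite hl.
have K0 : 0 <= N + n.+1%:R * M by rewrite addr_ge0// mulr_ge0.
have hE := ext_cochD K0 hF.
exists (cobD act (ext (n := n) F)); split.
- by exists (ext (n := n) F); split=> // a xi.
- exact: (cobD_smulti Hact (cochD_smulti hE)).
move=> l s hl.
rewrite /bcoefD -/(bcoefD z l s) -/(bcoefD (cobD act (ext (n := n) F)) l s) bcoefD_cob//.
rewrite (@eq_bar _ _ _ act n _ F l s hl); last by move=> k t hk; exact: bcoefD_ext.
rewrite barB (bar_pull Hact tau_base base_act).
have hst : forall g, g \in ret_seq l s -> act g (base s) = base s.
  exact: (ret_seq_stab Hact tau_base base_act).
have -> : bar act (prism (bcoefD z)) l s = pull (bcoefD z) l s - bcoefD z l s.
  have [g [k E]] : exists g k, l = g :: k by case: l hl {hst} => // g k; exists g, k.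
  rewrite E -(prism_homotopy Hact tau_base base_act) -E.
  have -> : prism (bar act (bcoefD z)) l s = 0 by apply: prism_eq0 hl _ => k' t; exact: cz.
  by rewrite add0r.
have hB : pull (bcoefF B') l s = pull (bar act (bcoefF Psi)) l s.
  have := @bcoefC_cob R G S act n Psi (ret_seq l s) (base s).
  rewrite size_ret_seq => /(_ hl hst) hC.
  rewrite /pullback -[RHS]hC /bcoefF /bcoefC -e//.
  by apply: l1s_bvec; [exact: stab1|exact: hst].
have -> : pull (bcoefF (fun x a => restrict z x a - B' x a)) l s =
  pull (bcoefD z) l s - pull (bcoefF B') l s by [].
by rewrite hB; ring.
Qed.

Hypothesis base_Lam : forall x, Lam x -> base x = x.
Hypothesis tau_Lam : forall x, Lam x -> tau x = 1%g.

(** At [x] in [Lam] every vertex along the string is [x] and [tau x] is 1, so the retraction fixes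
    each arrow. *)
Lemma pull_Lam (F : seq G -> S -> C) l x : Lam x ->
  (forall g, g \in l -> act g x = x) -> pull F l x = F l x.
Proof.
move=> Lx hl; rewrite /pullback base_Lam//; congr F.
have fix_l k : (forall g, g \in k -> act g x = x) -> lact_seq act k x = x.
  elim: k => //= g k ih h; rewrite ih ?h ?mem_head// => u uk.
  by apply: h; rewrite inE uk orbT.
elim: l hl => //= g l ih hl.
have hl' u : u \in l -> act u x = x by move=> ul; apply: hl; rewrite inE ul orbT.
rewrite ih// fix_l// /ret hl ?mem_head// tau_Lam//.
by rewrite invg1 mul1g mulg1.
Qed.

Definition lift_cochain n (y : cochainF n) : cochainD n := ext (pull (bcoefF y)).

Lemma lift_cochain_cocycD n (y : cochainF n) : cocycF act Lam y -> cocycD act (lift_cochain y).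
Proof.
move=> [hy cy]; have [M M0 hM] := cochF_unit hy.
have hF l s : size l = n -> cabs (pull (bcoefF y) l s) <= M.
  by move=> _; exact: pull_bcoefF_le.
have hz := ext_cochD M0 hF; split=> //.
apply: (smulti_dual_eq (cobD_smulti Hact (cochD_smulti hz)) (@smulti_dual_0 n.+1)) => l s hl.
rewrite bcoefD_cob// (@eq_bar _ _ _ act n _ (pull (bcoefF y)) l s hl); last first.
  by move=> k t hk; exact: bcoefD_ext.
rewrite (bar_pull Hact tau_base base_act).
have hst : forall g, g \in ret_seq l s -> act g (base s) = base s.
  exact: (ret_seq_stab Hact tau_base base_act).
have := @bcoefC_cob R G S act n y (ret_seq l s) (base s).
rewrite size_ret_seq => /(_ hl hst) e.
transitivity (bcoefC (cobC (y (base s))) (ret_seq l s)); first by rewrite e.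
by apply: (cy _ (Lam_base s)); apply: l1s_bvec; [exact: stab1|exact: hst].
Qed.

Lemma restrict_lift_cochainK n (y : cochainF n) : cochF act Lam y ->
  eqF act Lam (restrict (lift_cochain y)) y.
Proof.
move=> hy x Lx; have [M M0 hM] := cochF_unit hy.
have hF l s : size l = n -> cabs (pull (bcoefF y) l s) <= M.
  by move=> _; exact: pull_bcoefF_le.
have hz := ext_cochD M0 hF.
have hr := restrict_cochF hz.
have sm (w : cochainF n) : cochF act Lam w -> smulti (stab act x) (w x).
  by move=> [hw _]; have [lin [N hN]] := hw x Lx; exact: smulti_of_lin lin hN.
apply: smulti_eq; [exact: sm hr|exact: sm hy|].
move=> l hl hst; rewrite /bcoefC /restrict -/(bcoefD (lift_cochain y) l x) bcoefD_ext//.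
exact: pull_Lam.
Qed.

Lemma qnorm_restrict n (z : cochainD n) : cocycD act z ->
  qnormF act Lam (restrict z) <= 1 * qnormD act z.
Proof.
move=> [hz _]; rewrite mul1r; apply: inf_le_inf.
- by eexists; exists (fun _ _ => 0); split; [exact: cobndD_0|reflexivity].
- by move=> r [B [_ ->]]; exact: normF_ge0.
move=> r [B [hB ->]].
exists (normF act Lam (fun x a => restrict z x a - restrict B x a)).
  by exists (restrict B); split=> //; exact: restrict_cobndF.
have [M M0 hM] := cochD_unit hz; have [N hN] := cobndD_unit hB.
apply: normF_le; first exact: normD_ge0.
move=> x a Lx ha; apply: (@le_normD _ _ _ _ (fun a xi => z a xi - B a xi) (M + N)).
- move=> b xi hb hxi hxi1; apply: le_trans (cabsD _ _) _.
  by rewrite cabsN lerD ?hM ?hN.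
- exact: unit_ball_sub ha.
- exact: (l1_delta R x).1.
- by rewrite l1norm_delta.
Qed.

(** Each correction [B'] of the restriction lifts to a correction [B] of [z] for which [z - B] has
    the coefficients of a pullback of [restrict z - B']. The prism is absorbed in [B], so its norm
    does not enter. *)
Lemma qnorm_restrict_ge n (z : cochainD n) : cocycD act z ->
  qnormD act z <= 1 * qnormF act Lam (restrict z).
Proof.
move=> hz; have [M M0 hM] := cochD_unit hz.1; rewrite mul1r; apply: inf_le_inf.
- eexists; exists (fun _ _ => 0); split; last reflexivity.
  exact: cobndF_eq0.
- by move=> r [B [_ ->]]; exact: normD_ge0.
move=> r [B' [hB' ->]].
have cz l s : size l = n.+1 -> bar act (bcoefD z) l s = 0.
  move=> hl; rewrite -bcoefD_cob//; apply: hz.2; last exact: (l1_delta R s).1.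
  exact: l1_bvec.
have [B [hB sB eB]] :=
  restrict_modulo_cobnd M0 (cochD_smulti hz.1) (bcoefD_le hM) cz hB'.
exists (normD (fun a xi => z a xi - B a xi)); first by exists B.
have [K hK] := cobndF_unit hB'.
have hu : forall x a, Lam x -> unit_ball (stab act x) a ->
    cabs (restrict z x a - B' x a) <= M + K.
  move=> x a Lx ha; apply: le_trans (cabsD _ _) _; rewrite cabsN lerD ?hK//.
  apply: hM; [exact: unit_ball_sub ha|exact: (l1_delta R x).1|by rewrite l1norm_delta].
set N := normF _ _ _.
have N0 : 0 <= N by exact: normF_ge0.
apply: normD_le => a xi ha hxi hxi1.
have ha' j := (ha j).1.1.
apply: le_trans (smulti_dual_bound (smulti_dualB (cochD_smulti hz.1) sB) N0 _ ha' hxi) _.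
  move=> l s hl; rewrite eB//; apply: pull_bcoefF_le.
  exact: (le_normF hu).
have /andP[p0 p1] := unit_ball_prod ha.
by rewrite -mulrA ler_piMr// mulr_ile1 ?l1norm_ge0.
Qed.

(** For the converse, [B'] is taken to be the restriction of [z - w] itself. What remains after the
    correction is then the pullback of zero, so [z - w] agrees with [B] on the basis. *)
Lemma restrict_cobnd_iff n (z w : cochainD n) : cocycD act z -> cocycD act w ->
  cobndD act (fun a xi => z a xi - w a xi) <->
  cobndF act Lam (fun x a => restrict z x a - restrict w x a).
Proof.
move=> hz hw; split=> [|hB']; first exact: restrict_cobndF.
have [M M0 hM] := cochD_unit hz.1; have [N N0 hN] := cochD_unit hw.1.
have sz := smulti_dualB (cochD_smulti hz.1) (cochD_smulti hw.1).
have hMN l s : cabs (bcoefD (fun a xi => z a xi - w a xi) l s) <= M + N.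
  apply: le_trans (cabsD _ _) _; rewrite cabsN; apply: lerD.
    exact: bcoefD_le hM l s.
  exact: bcoefD_le hN l s.
have cz l s : size l = n.+1 -> bar act (bcoefD (fun a xi => z a xi - w a xi)) l s = 0.
  move=> hl; rewrite (barB act (bcoefD z) (bcoefD w)) -!bcoefD_cob//.
  rewrite /bcoefD hz.2 ?hw.2 ?subr0//; try exact: l1_bvec; exact: (l1_delta R s).1.
have [B [hB sB eB]] := restrict_modulo_cobnd (addr_ge0 M0 N0) sz hMN cz hB'.
apply: cobndD_eq hB; apply: smulti_dual_eq => // l s hl.
have := eB l s hl; rewrite /pullback /bcoefF /bcoefC /restrict subrr => /eqP.
by rewrite /bcoefD subr_eq0 => /eqP.
Qed.

End Shapiro.

(** * Choice of orbit representatives, and the isomorphism *)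

Lemma orbit_section (G : groupType) (S : choiceType) (act : G -> S -> S) (Lam : set S) :
  left_action act -> orbit_transversal act Lam ->
  exists base : S -> S, exists tau : S -> G,
  [/\ forall s, act (tau s) (base s) = s, forall g s, base (act g s) = base s,
      forall s, Lam (base s), forall x, Lam x -> base x = x &
      forall x, Lam x -> tau x = 1%g].
Proof.
move=> Hact [ex un].
(* A single choice provides the representative and the group element, with the normalisation on
   [Lam] built into the chosen predicate. *)
have /choice[p hp] s : exists p : S * G,
    [/\ Lam p.1, act p.2 p.1 = s & Lam s -> p = (s, 1%g)].
  have [Ls|nLs] := pselect (Lam s); first by exists (s, 1%g); split=> //; exact: Hact.1.
  by have [x [Lx [g gx]]] := ex s; exists (x, g).
exists (fun s => (p s).1), (fun s => (p s).2); split.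
- by move=> s; case: (hp s).
- move=> g s; have [L1 e1 _] := hp (act g s); have [L2 e2 _] := hp s.
  (* This element carries the representative of [s] through [s] and [g s] to that of [g s], so the
     transversal forces the two to coincide. *)
  apply/esym/(un _ _ ((p (act g s)).2^-1 * (g * (p s).2))%g) => //.
  by rewrite !Hact.2 e2 -{2}e1 actK.
- by move=> s; case: (hp s).
- by move=> x Lx; case: (hp x) => _ _ ->.
- by move=> x Lx; case: (hp x) => _ _ ->.
Qed.

Theorem theorem4p1 (R : realType) (G : groupType) (S : choiceType)
  (act : G -> S -> S) (Lam : set S)
  (Hact : left_action act) (HLam : orbit_transversal act Lam) (n : nat) :
  topiso
    (* X = C^n(l^1(G), l^1(S)'), pointwise operations *)
    (fun (P Q : ('I_n -> G -> R[i]) -> (S -> R[i]) -> R[i]) a xi => P a xi + Q a xi)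
    (fun (c : R[i]) (P : ('I_n -> G -> R[i]) -> (S -> R[i]) -> R[i]) a xi => c * P a xi)
    (fun (P Q : ('I_n -> G -> R[i]) -> (S -> R[i]) -> R[i]) a xi => P a xi - Q a xi)
    (* Y = l^oo-sum over x in Lam of C^n(l^1(H_x), C), pointwise operations *)
    (fun (P Q : S -> ('I_n -> G -> R[i]) -> R[i]) x a => P x a + Q x a)
    (fun (c : R[i]) (P : S -> ('I_n -> G -> R[i]) -> R[i]) x a => c * P x a)
    (fun (P Q : S -> ('I_n -> G -> R[i]) -> R[i]) x a => P x a - Q x a)
    (@cocycD R G S act n) (@cobndD R G S act n) (@qnormD R G S act n)
    (@cocycF R G S act Lam n) (@cobndF R G S act Lam n) (@qnormF R G S act Lam n).
Proof.
have [base [tau [h1 h2 h3 h4 h5]]] := orbit_section Hact HLam.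
exists (@restrict R G S n); split.
- by move=> z; exact: restrict_cocycF.
- by move=> z w c _ _; apply: cobndF_eq0 => x Lx a _; rewrite /restrict subrr.
- by move=> z w hz hw; exact: (restrict_cobnd_iff Hact h1 h2 h3).
- move=> y hy; exists (lift_cochain act base tau y); first exact: (lift_cochain_cocycD Hact h1 h2 h3).
  apply: cobndF_eq0 => x Lx a ha.
  by rewrite (restrict_lift_cochainK Hact h1 h2 h3 h4 h5 hy.1 Lx)// subrr.
(* With both constants equal to 1 the induced bijection preserves the quotient seminorms. *)
- exists 1, 1 => z hz; split; first exact: qnorm_restrict.
  exact: (qnorm_restrict_ge Hact h1 h2 h3).
Qed.
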